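(* Let $k$ be a field of characteristic zero, let $a\in k[h]$ be a non-constant polynomial, let $h_0\in k\setminus\{0\}$ and let $\sigma$ be the $k$-algebra automorphism of $k[h]$ with $\sigma(h)=h-h_0$. Let $A=A(k[h],a,\sigma)$ be the generalized Weyl algebra, put $n=\deg a$ and $d=\deg(a;a')$, where $a'$ is the formal derivative of $a$ and $(a;a')$ is the (monic) greatest common divisor of $a$ and $a'$. Then for the Hochschild cohomology $H\!H^*(A)=\operatorname{Ext}_{A\otimes A^{op}}^*(A,A)$: \begin{itemize} \item if $(a;a')=1$ (i.e. $d=0$), then $\dim_k H\!H^0(A)=1$, $\dim_k H\!H^2(A)=n-1$, and $H\!H^i(A)=0$ for $i\neq 0,2$; \item if $d\geq 1$, then $\dim_k H\!H^0(A)=1$, $\dim_k H\!H^1(A)=0$, $\dim_k H\!H^2(A)=n-1$, and $\dim_k H\!H^i(A)=d$ for all $i\geq 3$. \end{itemize}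
   Context: For a $k$-algebra $R$, a central element $a\in R$ and $\sigma\in\mathrm{Aut}_k(R)$, the generalized Weyl algebra $A(R,a,\sigma)$ is the $k$-algebra generated by $R$ and two new variables $x,y$ subject to the relations $yx=a$, $xy=\sigma(a)$, $xr=\sigma(r)x$ and $ry=y\sigma(r)$ for all $r\in R$. Here $R=k[h]$. *)

(* Defs.v *)
From HB Require Import structures.
From mathcomp Require Import all_boot all_order all_algebra.
Set Implicit Arguments. Unset Strict Implicit. Unset Printing Implicit Defensive.
Import Order.TTheory GRing.Theory Num.Theory.
Local Open Scope ring_scope.

Section GWA.
Variable k : fieldType.

Definition peval (B : algType k) (p : {poly k}) (h : B) : B :=
  \sum_(i < size p) p`_i *: h ^+ i.

(* Defining relations of A(k[h], a, sigma), sigma(h) = h - h0, written on the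
   generators h, x, y:  x h = sigma(h) x,  h y = y sigma(h),  y x = a,
   x y = sigma(a) = a(h - h0). *)
Definition gwa_rel (a : {poly k}) (h0 : k) (C : algType k) (h x y : C) : Prop :=
  [/\ x * h = (h - h0%:A) * x,
      h * y = y * (h - h0%:A),
      y * x = peval a h
    & x * y = peval (a \Po ('X - h0%:P)) h].

(* B (with h, x, y) is the generalized Weyl algebra A(k[h], a, sigma):
   the k-algebra presented by generators h, x, y and the relations above,
   i.e. the relations hold and B has the universal property of the presentation. *)
Definition is_GWA (a : {poly k}) (h0 : k) (B : algType k) (h x y : B) : Prop :=
  gwa_rel a h0 h x y /\
  forall (C : algType k) (h' x' y' : C), gwa_rel a h0 h' x' y' ->
    (exists f : {lrmorphism B -> C}, [/\ f h = h', f x = x' & f y = y']) /\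
    (forall f g : {lrmorphism B -> C},
        f h = g h -> f x = g x -> f y = g y -> f =1 g).

Section Hochschild.
Variable B : algType k.

Definition cochain (n : nat) := {ffun 'I_n -> B} -> B.

Definition upd n (u : {ffun 'I_n -> B}) (i : 'I_n) (v : B) : {ffun 'I_n -> B} :=
  [ffun j => if j == i then v else u j].

(* k-multilinearity, i.e. f is a k-linear map B^{(x)n} -> B. *)
Definition multilinear n (f : cochain n) : Prop :=
  forall (i : 'I_n) (u : {ffun 'I_n -> B}) (c : k) (v w : B),
    f (upd u i (c *: v + w)) = c *: f (upd u i v) + f (upd u i w).

Definition tup n (g : nat -> B) : {ffun 'I_n -> B} := [ffun j => g (val j)].
Definition get n (u : {ffun 'I_n.+1 -> B}) (m : nat) : B := u (inord m).

Definition hoch_d n (f : cochain n) : cochain n.+1 := fun u =>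
  get u 0 * f (tup n (fun m => get u m.+1))
  + \sum_(i < n) (-1) ^+ i.+1 *
       f (tup n (fun m => if (m < i)%N then get u m
                          else if m == val i then get u i * get u i.+1
                          else get u m.+1))
  + (-1) ^+ n.+1 * (f (tup n (fun m => get u m)) * get u n).

Definition cocycle n (f : cochain n) : Prop :=
  multilinear f /\ forall u, hoch_d f u = 0.

Definition coboundary n : cochain n -> Prop :=
  match n return cochain n -> Prop with
  | 0 => fun f => forall u, f u = 0
  | m.+1 => fun f => exists g : cochain m,
              multilinear g /\ forall u, f u = hoch_d g u
  end.

(* dim_k HH^n(B) = m : there are m cocycles whose classes form a k-basis of
   the quotient space  Z^n / B^n  (cocycles modulo coboundaries). *)
Definition HH_dim (n m : nat) : Prop :=
  exists c : 'I_m -> cochain n,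
    [/\ forall j, cocycle (c j),
        forall f : cochain n, cocycle f ->
          exists coef : 'I_m -> k,
            coboundary (fun u => f u - \sum_(j < m) coef j *: c j u)
      & forall coef : 'I_m -> k,
          coboundary (fun u => \sum_(j < m) coef j *: c j u) ->
          forall j, coef j = 0].

End Hochschild.
End GWA.

(* Main.v *)
(**
  Write gen true = x, gen false = y, hshift true = h and hshift false = h - h0. The relations
  then take the symmetric form gen e * hshift e = hshift (~~ e) * gen e and
  gen (~~ e) * gen e = a(hshift e). Over the base ring k[h] the algebra has an Anick-type
  resolution with one generator for each alternating word in x and y (two in every positive
  length); resolving k[h] by the commutator with h as well gives a free bimodule resolution with
  generators the words w of length q and the symbols h w with w of length q - 1.

  For a bimodule M the cochains with values in M form the small complex of M. Let N_P be the
  bimodule of P-linear maps B^P -> B, with B acting on the values and on the first argument. The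
  small complexes of N_0 = B, N_1, N_2, ... are the columns of a double complex whose rows are
  bar complexes without their first face. Rows are contracted by inserting 1, columns with P > 0
  are exact by the basis theorem, and a zigzag identifies Hochschild cohomology with the
  cohomology of the small complex of B.

  On the latter ad h acts diagonally with eigenvalues in h0 * Z, so in characteristic 0 only
  cochains of weight zero matter; they are given by pairs of polynomials. The complex of words
  has cohomology k in degree 0, k[h]/(a) in positive even degrees and 0 in odd degrees, and the
  two parts are glued by multiplication by a'. Hence the answer: k, 0, k[h]/(a, k a') in
  degrees 0, 1, 2, and then alternately the annihilator of a' in k[h]/(a) and k[h]/(a, a').
*)
Require Import Defs.
From HB Require Import structures.
From mathcomp Require Import all_boot all_order all_algebra.
From mathcomp Require Import boolp functions.
From mathcomp Require Import ring zify.
Set Implicit Arguments. Unset Strict Implicit. Unset Printing Implicit Defensive.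
Import Order.TTheory GRing.Theory Num.Theory.
Local Open Scope ring_scope.

(** * Linear maps given as bare functions, and modules of functions *)

Section UnbundledLinear.
Variables (k : pzRingType) (U V : lmodType k) (F : U -> V).
Hypothesis lF : linear F.
Lemma lfunD u v : F (u + v) = F u + F v.
Proof. by have := lF 1 u v; rewrite !scale1r. Qed.
Lemma lfun0 : F 0 = 0.
Proof. by apply: (addrI (F 0)); rewrite -lfunD !addr0. Qed.
Lemma lfunZ c u : F (c *: u) = c *: F u.
Proof. by have := lF c u 0; rewrite lfun0 !addr0. Qed.
Lemma lfunN u : F (- u) = - F u.
Proof. by rewrite -scaleN1r lfunZ scaleN1r. Qed.
Lemma lfunB u v : F (u - v) = F u - F v.
Proof. by rewrite lfunD lfunN. Qed.
Lemma lfun_sum (I : Type) (r : seq I) (P : pred I) (G : I -> U) :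
  F (\sum_(i <- r | P i) G i) = \sum_(i <- r | P i) F (G i).
Proof. exact: (big_morph F lfunD lfun0). Qed.
End UnbundledLinear.

Section PointwiseApply.
Variables (k : pzRingType) (T : Type) (N : lmodType k).
Implicit Types F G : T -> N.
Lemma addappE F G t : (F + G) t = F t + G t. Proof. by []. Qed.
Lemma oppappE F t : (- F) t = - F t. Proof. by []. Qed.
Lemma scaleappE c F t : (c *: F) t = c *: F t. Proof. by []. Qed.
Lemma zeroappE t : (0 : T -> N) t = 0. Proof. by []. Qed.
Definition fappE := (addappE, oppappE, scaleappE, zeroappE).
End PointwiseApply.

(** * Endomorphism algebras and subalgebras *)

Section EndAlgebra.
Variables (k : fieldType) (V : lmodType k).

Record endo := Endo { endo_fun :> V -> V; endo_linear : linear endo_fun }.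

Lemma endoP (f g : endo) : f =1 g -> f = g.
Proof.
case: f g => [f lf] [g lg] /= /funext fg; subst g.
by congr Endo; apply: Prop_irrelevance.
Qed.

HB.instance Definition _ := gen_eqMixin endo.
HB.instance Definition _ := gen_choiceMixin endo.

Lemma endoD (f : endo) u v : f (u + v) = f u + f v.
Proof. exact: lfunD (endo_linear f) u v. Qed.

Lemma endoZ (f : endo) c u : f (c *: u) = c *: f u.
Proof. exact: lfunZ (endo_linear f) c u. Qed.

Fact endo_zero_subproof : linear (fun _ : V => 0 : V).
Proof. by move=> c u v; rewrite scaler0 addr0. Qed.
Fact endo_opp_subproof (f : endo) : linear (fun u => - f u).
Proof. by move=> c u v; rewrite endo_linear opprD scalerN. Qed.
Fact endo_add_subproof (f g : endo) : linear (fun u => f u + g u).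
Proof. by move=> c u v; rewrite !endo_linear scalerDr addrACA. Qed.
Fact endo_one_subproof : linear (fun u : V => u).
Proof. by []. Qed.
Fact endo_mul_subproof (f g : endo) : linear (fun u => f (g u)).
Proof. by move=> c u v; rewrite !endo_linear. Qed.
Fact endo_scale_subproof (a : k) (f : endo) : linear (fun u => a *: f u).
Proof. by move=> c u v; rewrite endo_linear scalerDr !scalerA mulrC. Qed.

Definition endo_zero := Endo endo_zero_subproof.
Definition endo_opp f := Endo (endo_opp_subproof f).
Definition endo_add f g := Endo (endo_add_subproof f g).
Definition endo_one := Endo endo_one_subproof.
Definition endo_mul f g := Endo (endo_mul_subproof f g).
Definition endo_scale a f := Endo (endo_scale_subproof a f).

Fact endo_addA : associative endo_add.
Proof. by move=> f g e; apply: endoP => u /=; rewrite addrA. Qed.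
Fact endo_addC : commutative endo_add.
Proof. by move=> f g; apply: endoP => u /=; rewrite addrC. Qed.
Fact endo_add0 : left_id endo_zero endo_add.
Proof. by move=> f; apply: endoP => u /=; rewrite add0r. Qed.
Fact endo_addN : left_inverse endo_zero endo_opp endo_add.
Proof. by move=> f; apply: endoP => u /=; rewrite addNr. Qed.
HB.instance Definition _ :=
  GRing.isZmodule.Build endo endo_addA endo_addC endo_add0 endo_addN.

Hypothesis V_neq0 : exists u : V, u != 0.

Fact endo_mulA : associative endo_mul.
Proof. by move=> f g e; apply: endoP. Qed.
Fact endo_mul1 : left_id endo_one endo_mul.
Proof. by move=> f; apply: endoP. Qed.
Fact endo_mulr1 : right_id endo_one endo_mul.
Proof. by move=> f; apply: endoP. Qed.
Fact endo_mulDl : left_distributive endo_mul +%R.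
Proof. by move=> f g e; apply: endoP. Qed.
Fact endo_mulDr : right_distributive endo_mul +%R.
Proof. by move=> f g e; apply: endoP => u /=; rewrite endoD. Qed.

(** The proof that V is nonzero is carried by the type, because the ring structure built on it
    demands that 1 differ from 0. *)
Definition endoA of (exists u : V, u != 0) := endo.
Local Notation E := (endoA V_neq0).
HB.instance Definition _ := GRing.Zmodule.on E.
Fact endo_one_neq0 : endo_one != 0 :> E.
Proof. by case: V_neq0 => u; apply: contra_neq => /(congr1 (fun f : endo => f u)). Qed.
HB.instance Definition _ := GRing.Zmodule_isNzRing.Build E
  endo_mulA endo_mul1 endo_mulr1 endo_mulDl endo_mulDr endo_one_neq0.

Fact endo_scaleA a b (f : E) : endo_scale a (endo_scale b f) = endo_scale (a * b) f.
Proof. by apply: endoP => u /=; rewrite scalerA. Qed.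
Fact endo_scale1 : left_id 1 endo_scale.
Proof. by move=> f; apply: endoP => u /=; rewrite scale1r. Qed.
Fact endo_scaleDr : right_distributive endo_scale (+%R : E -> E -> E).
Proof. by move=> a f g; apply: endoP => u /=; rewrite scalerDr. Qed.
Fact endo_scaleDl (f : E) : {morph (fun a => endo_scale a f : E) : a b / a + b}.
Proof. by move=> a b; apply: endoP => u /=; rewrite scalerDl. Qed.
HB.instance Definition _ := GRing.Zmodule_isLmodule.Build k E
  endo_scaleA endo_scale1 endo_scaleDr endo_scaleDl.

Fact endo_scaleAl (a : k) (f g : E) : a *: (f * g) = (a *: f) * g.
Proof. by apply: endoP. Qed.
HB.instance Definition _ := GRing.Lmodule_isLalgebra.Build k E endo_scaleAl.
Fact endo_scaleAr (a : k) (f g : E) : a *: (f * g) = f * (a *: g).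
Proof. by apply: endoP => u; rewrite [RHS]endoZ. Qed.
HB.instance Definition _ := GRing.Lalgebra_isAlgebra.Build k E endo_scaleAr.

Lemma endoAD (f g : E) u : (f + g) u = f u + g u. Proof. by []. Qed.
Lemma endoAN (f : E) u : (- f) u = - f u. Proof. by []. Qed.
Lemma endoAM (f g : E) u : (f * g) u = f (g u). Proof. by []. Qed.
Lemma endoAZ c (f : E) u : (c *: f) u = c *: f u. Proof. by []. Qed.
Lemma endoA1 u : (1 : E) u = u. Proof. by []. Qed.
Lemma endoA0 u : (0 : E) u = 0. Proof. by []. Qed.
Definition endoAE := (endoAD, endoAN, endoAM, endoAZ, endoA1, endoA0).

End EndAlgebra.

Section SubAlgebra.
Variables (k : fieldType) (B : algType k) (S : pred B).
Hypothesis closedS : GRing.subsemialg_closed S.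

Record subalg := SubAlg { subalg_val : B; subalg_valP : S subalg_val }.
HB.instance Definition _ := [isSub for subalg_val].
HB.instance Definition _ := [Choice of subalg by <:].
Definition subalgA of (GRing.subsemialg_closed S) := subalg.
HB.instance Definition _ := SubChoice.on (subalgA closedS).
HB.instance Definition _ := GRing.SubChoice_isSubAlgebra.Build _ _ _ (subalgA closedS) closedS.

Definition subalg_incl (u : subalgA closedS) : B := \val u.
Fact subalg_incl_linear : linear subalg_incl.
Proof.
exact: (linearP ((\val : subalgA closedS -> B) : {linear subalgA closedS -> B})).
Qed.
Fact subalg_incl_monoid_morphism : monoid_morphism subalg_incl.
Proof.
by split; [exact: rmorph1 | exact: rmorphM].
Qed.
HB.instance Definition _ :=
  GRing.isLinear.Build k (subalgA closedS) B *:%R subalg_incl subalg_incl_linear.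
HB.instance Definition _ :=
  GRing.isMonoidMorphism.Build (subalgA closedS) B subalg_incl subalg_incl_monoid_morphism.
End SubAlgebra.

(** * The basis theorem for the presented algebra *)

Lemma peval_horner (k : fieldType) (B : algType k) (p : {poly k}) (b : B) :
  peval p b = horner_alg b p.
Proof.
rewrite /peval /horner_alg /horner_morph horner_coef size_map_poly.
by apply: eq_bigr => i _; rewrite coef_map /= mulr_algl.
Qed.

Lemma peval_morph (k : fieldType) (B C : algType k) (f : {lrmorphism B -> C}) p b :
  f (peval p b) = peval p (f b).
Proof. by rewrite /peval raddf_sum; apply: eq_bigr => i _; rewrite -rmorphXn -linearZ_LR. Qed.

Section Shift.
Variables (k : fieldType) (h0 : k).
Implicit Types p q : {poly k}.
(** [sh] is the automorphism sigma of k[h] and [shi] is its inverse. *)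
Definition sh p := p \Po ('X - h0%:P).
Definition shi p := p \Po ('X + h0%:P).
Lemma shK p : shi (sh p) = p.
Proof. by rewrite /shi /sh -comp_polyA comp_polyB comp_polyX comp_polyC addrK comp_polyXr. Qed.
Lemma shiK p : sh (shi p) = p.
Proof. by rewrite /shi /sh -comp_polyA comp_polyD comp_polyX comp_polyC subrK comp_polyXr. Qed.
End Shift.

Section PolyValue.
Variables (k : fieldType) (N : lmodType k) (L : nat -> N).
(** The linear extension to k[h] of the values [L i] prescribed at the powers ['X^i]. *)
Definition polyval (p : {poly k}) : N := \sum_(i < size p) p`_i *: L i.

Lemma polyval_widen n (p : {poly k}) : (size p <= n)%N -> polyval p = \sum_(i < n) p`_i *: L i.
Proof.
move=> pn; rewrite /polyval (big_ord_widen _ (fun i => p`_i *: L i) pn) big_mkcond /=.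
by apply: eq_bigr => i _; case: ltnP => // /(nth_default 0) ->; rewrite scale0r.
Qed.

Lemma polyval_linear : linear polyval.
Proof.
move=> c p q; pose n := maxn (size (c *: p + q)) (maxn (size p) (size q)).
rewrite !(@polyval_widen n) ?leq_max ?leqnn ?orbT // scaler_sumr -big_split /=.
by apply: eq_bigr => i _; rewrite coefD coefZ scalerDl scalerA.
Qed.

Lemma polyval0 : polyval 0 = 0.
Proof. by rewrite /polyval size_poly0 big_ord0. Qed.

Lemma polyvalXn n : polyval 'X^n = L n.
Proof.
rewrite /polyval size_polyXn big_ord_recr /= big1 => [|i _].
  by rewrite coefXn eqxx scale1r add0r.
by rewrite coefXn ltn_eqF ?scale0r.
Qed.
End PolyValue.

Lemma linear_sum_fun (k : fieldType) (U N : lmodType k) (I : Type) (r : seq I) (F : I -> U ->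
  N) :
  (forall i, linear (F i)) -> linear (fun u => \sum_(i <- r) F i u).
Proof.
move=> lF c u v; elim: r => [|i r IH]; first by rewrite !big_nil scaler0 addr0.
by rewrite !big_cons IH lF scalerDr addrACA.
Qed.

Section Presentation.
Variables (k : fieldType) (a : {poly k}) (h0 : k) (B : algType k) (h x y : B).
Hypothesis HB : is_GWA a h0 h x y.

(* The subalgebra on S satisfies the relations, so the universal property retracts B onto it. *)
Lemma gwa_ind (S : B -> Prop) :
  S 1 -> (forall c u v, S u -> S v -> S (c *: u + v)) ->
  (forall u v, S u -> S v -> S (u * v)) -> S h -> S x -> S y -> forall b, S b.
Proof.
move=> S1 SD SM Sh Sx Sy; pose P : pred B := fun b => `[< S b >].
have S0 : S 0 by have := SD (-1) _ _ S1 S1; rewrite scaleN1r addNr.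
have closedP : GRing.subsemialg_closed P.
  split; first exact/asboolP.
  - split; first exact/asboolP.
    by move=> u v /asboolP Su /asboolP Sv; apply/asboolP; rewrite -[u]scale1r; apply: SD.
  - by move=> c u /asboolP Su; apply/asboolP; rewrite -[_ *: _]addr0; apply: SD.
  - by move=> u v /asboolP Su /asboolP Sv; apply/asboolP; apply: SM.
pose C : algType k := subalgA closedP.
pose mkC u (Su : S u) : C := SubAlg (introT (asboolP _) Su : P u).
pose vC : {lrmorphism subalgA closedP -> B} := @subalg_incl _ _ _ closedP.
have [[xh hy yx xy] univ] := HB.
have [|[f [fh fx fy]] _] := univ C (mkC h Sh) (mkC x Sx) (mkC y Sy).
  have vB (u : C) (c : k) : vC (u - c%:A) = vC u - c%:A.
    by rewrite raddfB linearZ_LR rmorph1.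
  have vI : injective vC by exact: val_inj.
  split; apply: vI.
  - by rewrite !rmorphM /= vB.
  - by rewrite !rmorphM /= vB.
  - by rewrite rmorphM peval_morph.
  - by rewrite rmorphM peval_morph.
have [_ /(_ (vC \o f : {lrmorphism B -> B}))] := univ B h x y HB.1.
move=> /(_ (idfun : {lrmorphism B -> B})) uniq b; have := uniq _ _ _ b.
rewrite /= fh fx fy => /(_ erefl erefl erefl) <-.
by apply/asboolP; exact: (subalg_valP (f b)).
Qed.

Definition gen (e : bool) : B := if e then x else y.
Definition hshift (e : bool) : B := h - (if e then 0 else h0)%:A.
Definition aval (e : bool) : B := peval a (hshift e).

Lemma hshift_true : hshift true = h. Proof. by rewrite /hshift scale0r subr0. Qed.

Lemma gen_hshift e : gen e * hshift e = hshift (~~ e) * gen e.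
Proof.
have [[xh hy _ _] _] := HB.
by case: e => /=; rewrite hshift_true /hshift /=; [exact: xh | rewrite hy].
Qed.

Lemma peval_comp (p q : {poly k}) (b : B) : peval (p \Po q) b = peval p (peval q b).
Proof.
rewrite !peval_horner; elim/poly_ind: p => [|p c IHp]; first by rewrite comp_poly0 !rmorph0.
by rewrite comp_poly_MXaddC !rmorphD !rmorphM /= IHp horner_algX !horner_algC.
Qed.

Lemma peval_hshift e : peval ('X - (if e then 0 else h0)%:P) h = hshift e.
Proof. by rewrite peval_horner rmorphB /= horner_algX horner_algC. Qed.

Lemma gen_gen e : gen (~~ e) * gen e = aval e.
Proof.
have [[_ _ yx xy] _] := HB.
case: e; rewrite /aval /=; first by rewrite yx hshift_true.
by rewrite xy peval_comp (peval_hshift false).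
Qed.

Lemma comm_expr (u v w : B) n : w * u = v * w -> w * u ^+ n = v ^+ n * w.
Proof.
move=> uv; elim: n => [|n IHn]; first by rewrite !expr0 mulr1 mul1r.
by rewrite exprS mulrA uv -mulrA IHn mulrA exprS.
Qed.

Lemma comm_peval (u v w : B) (p : {poly k}) : w * u = v * w -> w * peval p u = peval p v * w.
Proof.
move=> uv; rewrite /peval big_distrl big_distrr /=; apply: eq_bigr => i _.
by rewrite -scalerAr -scalerAl (comm_expr _ uv).
Qed.

Lemma gen_peval e p : gen e * peval p (hshift e) = peval p (hshift (~~ e)) * gen e.
Proof. by apply: comm_peval; exact: gen_hshift. Qed.

(** The inductive form gives an induction along the normal monomials [h ^+ i * gen e ^+ j]. For j =
    0 both values of [e] give the same monomial, which is why a compatibility at j = 0 recurs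
    below. *)
Inductive gspan : B -> Prop :=
| gspan0 : gspan 0
| gspanD c e j i v : gspan v -> gspan (c *: (h ^+ i * gen e ^+ j) + v).

Lemma gspan_add u v : gspan u -> gspan v -> gspan (u + v).
Proof. by move=> su sv; elim: su => [|c e j i w _ IH]; rewrite ?add0r // -addrA;
  apply: gspanD. Qed.

Lemma gspan_scale c u : gspan u -> gspan (c *: u).
Proof.
elim=> [|d e j i w _ IH]; first by rewrite scaler0; apply: gspan0.
by rewrite scalerDr scalerA; apply: gspanD.
Qed.

Lemma gspan_peval p e j : gspan (peval p h * gen e ^+ j).
Proof.
rewrite /peval big_distrl /=.
elim: (index_enum _) => [|i s IH]; first by rewrite big_nil; apply: gspan0.
by rewrite big_cons -scalerAl; apply: gspanD.
Qed.

Lemma gen_peval_h e p : gen e * peval p h =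
  peval (p \Po ('X - (if e then h0 else - h0)%:P)) h * gen e.
Proof.
rewrite peval_comp; apply: comm_peval.
rewrite peval_horner rmorphB /= horner_algX horner_algC.
have [[xh hy _ _] _] := HB; case: e => //=.
by rewrite scaleNr opprK mulrDl hy mulrBr mulr_algl mulr_algr subrK.
Qed.

Lemma peval_mul p q b : peval (p * q) b = peval p b * peval q b :> B.
Proof. by rewrite !peval_horner rmorphM. Qed.
Lemma pevalX b : peval 'X b = b :> B.
Proof. by rewrite peval_horner horner_algX. Qed.
Lemma pevalXn n b : peval 'X^n b = b ^+ n :> B.
Proof. by rewrite peval_horner rmorphXn /= horner_algX. Qed.
Lemma peval_lin b : linear (fun p => peval p b : B).
Proof. by move=> c p q; rewrite !peval_horner -mul_polyC rmorphD rmorphM /= horner_algC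
  mulr_algl. Qed.

Lemma aval_h e : aval e = peval (a \Po ('X - (if e then 0 else h0)%:P)) h.
Proof. by rewrite peval_comp peval_hshift. Qed.

Lemma gspan_gen e b : gspan b -> gspan (gen e * b).
Proof.
elim=> [|c e' j i v _ IH]; first by rewrite mulr0; apply: gspan0.
rewrite mulrDr; apply: gspan_add => //; rewrite -scalerAr; apply: gspan_scale.
rewrite -pevalXn mulrA gen_peval_h -mulrA.
have [<-|/eqP] := eqVneq e e'; first by rewrite -exprS; exact: gspan_peval.
case: j => [|j] ee'; first by rewrite expr0 mulr1 -[gen e]expr1; exact: gspan_peval.
(* Opposite letters meet and collapse to a polynomial in h, so the power of the letter drops by
   one. *)
rewrite exprS [gen e * _]mulrA; have ->: e = ~~ e' by move: (e) (e') ee' => [] [].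
by rewrite gen_gen aval_h mulrA -peval_mul; exact: gspan_peval.
Qed.

Lemma gspan_all b : gspan b.
Proof.
(* Preserving the span under left multiplication is visibly closed under products, as [gwa_ind]
   requires; the span itself is not. *)
pose S b := forall v, gspan v -> gspan (b * v).
suff Sb : S b by rewrite -[b]mulr1 -[1](mulr1 1); apply: Sb;
  rewrite -[1 * 1]addr0 -[1 * 1]scale1r -{1}(expr0 h) -(expr0 (gen true)); apply/gspanD/gspan0.
move: b; apply: gwa_ind; rewrite /S.
- by move=> v; rewrite mul1r.
- by move=> c u v su sv w sw; rewrite mulrDl -scalerAl; apply: gspan_add; [apply: gspan_scale;
  apply: su | apply: sv].
- by move=> u v su sv w sw; rewrite -mulrA; apply/su/sv.
- move=> v; elim=> [|c e j i w _ IH]; first by rewrite mulr0; apply: gspan0.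
  by rewrite mulrDr -scalerAr mulrA -exprS; apply: gspanD.
- exact: (gspan_gen true).
- exact: (gspan_gen false).
Qed.

(** The spanning half of the basis theorem. *)
Lemma linear_ext (N : lmodType k) (F G : B -> N) : linear F -> linear G ->
  (forall e j i, F (h ^+ i * gen e ^+ j) = G (h ^+ i * gen e ^+ j)) -> F =1 G.
Proof.
move=> lF lG FG b; elim: (gspan_all b) => [|c e j i v _ IH]; last by rewrite lF lG FG IH.
by have := lF (-1) 0 0; have := lG (-1) 0 0; rewrite !scaleN1r !addNr => -> ->.
Qed.

(* The regular module of the algebra, in the coordinates m |-> coefficient of x^m (m >= 0) or
   y^(-m) (m <= 0); functions of infinite support are harmless here. *)
Section Representation.

Notation V := (int -> {poly k}).
Implicit Types v : V.
Lemma V_neq0 : exists v : V, v != 0.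
Proof. by exists (fun=> 1); apply/eqP => /(congr1 (fun f : V => f 0)) /eqP;
  rewrite oner_eq0. Qed.
Notation E := (endoA V_neq0).

Definition rh_fun v : V := fun m => 'X * v m.
(** The extra factor appears exactly when the new letter cancels an opposite one: x y = sigma(a)
    when x arrives at m <= 0, and y x = a when y arrives at m >= 0. *)
Definition rx_fun v : V := fun m => sh h0 (v (m - 1)) * (if m <= 0 then sh h0 a else 1).
Definition ry_fun v : V := fun m => shi h0 (v (m + 1)) * (if 0 <= m then a else 1).
Fact rh_lin : linear rh_fun.
Proof. by move=> c u v; apply/funext => m; rewrite /rh_fun !fctE mulrDr -scalerAr. Qed.
Fact rx_lin : linear rx_fun.
Proof.
by move=> c u v; apply/funext => m;
  rewrite /rx_fun !fctE /sh comp_polyD comp_polyZ mulrDl -scalerAl.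
Qed.
Fact ry_lin : linear ry_fun.
Proof.
by move=> c u v; apply/funext => m;
  rewrite /ry_fun !fctE /shi comp_polyD comp_polyZ mulrDl -scalerAl.
Qed.
Definition rh : E := Endo rh_lin.
Definition rx : E := Endo rx_lin.
Definition ry : E := Endo ry_lin.

Lemma rhE v m : rh v m = 'X * v m. Proof. by []. Qed.
Lemma rxE v m : rx v m = sh h0 (v (m - 1)) * (if m <= 0 then sh h0 a else 1).
Proof. by []. Qed.
Lemma ryE v m : ry v m = shi h0 (v (m + 1)) * (if 0 <= m then a else 1).
Proof. by []. Qed.

Lemma peval_rh p v m : (peval p rh : E) v m = p * v m.
Proof.
rewrite peval_horner; elim/poly_ind: p v => [|p c IHp] v; first by rewrite rmorph0 mul0r.
rewrite rmorphD rmorphM /= horner_algX horner_algC mulrDl mul_polyC.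
by rewrite !endoAE !fctE IHp rhE mulrA.
Qed.

Lemma rep_rel : gwa_rel a h0 rh rx ry.
Proof.
split; apply: endoP => v; apply/funext => m.
- rewrite !endoAE rxE !fctE !rhE rxE /sh comp_polyM comp_polyX -mul_polyC.
  by ring.
- rewrite !endoAE rhE !ryE !fctE rhE /shi -mul_polyC comp_polyB !comp_polyM comp_polyX
  comp_polyC.
  by ring.
- rewrite endoAM peval_rh ryE rxE addrK.
  have -> : (m + 1 <= 0) = ~~ (0 <= m) by lia.
  by case: (0 <= m); rewrite /= ?mulr1 ?shK [RHS]mulrC // /shi comp_polyM -/(shi _ _) -/(shi _
    _) !shK.
- rewrite endoAM peval_rh rxE ryE subrK -/(sh h0 a).
  have -> : (0 <= m - 1) = ~~ (m <= 0) by lia.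
  by case: (m <= 0); rewrite /= ?mulr1 ?shiK [RHS]mulrC // /sh comp_polyM -/(sh _ _) -/(sh _
    _) !shiK.
Qed.

(** The unit of the regular module; applying the image of b to it returns the coordinates of b. *)
Definition delta : V := fun m => if m == 0 then 1 else 0.

Lemma rx_iter j m : (rx ^+ j : E) delta m = if m == j%:Z then 1 else 0.
Proof.
elim: j m => [|j IHj] m //; rewrite exprS endoAM rxE IHj.
have -> : (m - 1 == j%:Z) = (m == j.+1%:Z) by lia.
case: eqP => [->|_]; last by rewrite /sh comp_poly0 mul0r.
by rewrite /sh comp_polyC mul1r.
Qed.

Lemma ry_iter j m : (ry ^+ j : E) delta m = if m == - j%:Z then 1 else 0.
Proof.
elim: j m => [|j IHj] m; first by rewrite oppr0.
rewrite exprS endoAM ryE IHj.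
have -> : (m + 1 == - j%:Z) = (m == - j.+1%:Z) by lia.
case: eqP => [->|_]; last by rewrite /shi comp_poly0 mul0r.
by rewrite /shi comp_polyC mul1r.
Qed.

Lemma exists_rep : exists f : {lrmorphism B -> E}, [/\ f h = rh, f x = rx & f y = ry].
Proof. by have [_ /(_ _ _ _ _ rep_rel)[]] := HB. Qed.

(** The coordinates are the entries of the image of [delta] at j or -j. At j = 0 the two signs read
    the same entry, hence the disjunction. *)
Lemma exists_coord : exists cf : bool -> nat -> B -> {poly k},
  (forall e j, linear (cf e j)) /\
  (forall e j e' j' p, cf e j (peval p h * gen e' ^+ j') =
     if ((e == e') || (j == 0%N)) && (j == j') then p else 0).
Proof.
have [f [fh fx fy]] := exists_rep.
exists (fun e j b => f b delta (if e then j%:Z else - j%:Z)); split => [e j c u v|e j e' j' p].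
  by rewrite linearP !endoAE.
have -> : f (peval p h * gen e' ^+ j') = (peval p rh : E) * (if e' then rx else ry) ^+ j'.
  by rewrite rmorphM rmorphXn /= (peval_morph f) fh; case: e'; rewrite ?fx ?fy.
rewrite endoAM peval_rh.
transitivity (p * (if ((e == e') || (j == 0%N)) && (j == j') then 1 else 0));
  last by case: ifP => _; rewrite ?mulr1 ?mulr0.
congr (p * _); case: e'; rewrite ?rx_iter ?ry_iter; congr (if _ then _ else _); case: e => /=;
  lia.
Qed.
End Representation.

(** The independence half of the basis theorem. The extension is an infinite sum over the powers of
    the letters, of which only finitely many terms are nonzero at a given element. *)
Lemma exists_linear_ext (N : lmodType k) (L : bool -> nat -> nat -> N) :
  L true 0%N =1 L false 0%N ->
  exists F : B -> N, linear F /\ forall e j i, F (h ^+ i * gen e ^+ j) = L e j i.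
Proof.
move=> L0; have [cf [cf_lin cfE]] := exists_coord.
(* The index of the y-part is shifted by one so that the pure powers of h are counted only once. *)
pose Fj j b := polyval (L true j) (cf true j b) + polyval (L false j.+1) (cf false j.+1 b).
pose FM M b := \sum_(0 <= j < M) Fj j b.
have FMlin M : linear (FM M).
  apply: linear_sum_fun => j c u v; rewrite /Fj !cf_lin !polyval_linear scalerDr.
  by rewrite addrACA.
have FMbas e j i M : (j < M)%N -> FM M (h ^+ i * gen e ^+ j) = L e j i.
  move=> jM; pose j0 := if e then j else j.-1.
  have Fjbas j' : Fj j' (h ^+ i * gen e ^+ j) = if j' == j0 then L e j i else 0.
    rewrite -pevalXn /Fj !cfE {}/j0.
    case: e => /=; rewrite ?eqSS ?andbF ?polyval0 ?addr0.
      by case: eqP => [->|]; rewrite ?polyvalXn ?polyval0.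
    case: j {jM} => [|j] /=; rewrite ?andbT ?andbF ?eqSS ?polyval0 ?addr0 ?add0r.
      by case: eqP => [->|]; rewrite ?polyvalXn ?polyval0 ?L0.
    have -> : (j' == 0%N) && (j' == j.+1) = false by case: j'.
    by rewrite polyval0 add0r; case: eqP => [->|]; rewrite ?polyvalXn ?polyval0.
  rewrite /FM (eq_bigr _ (fun j' _ => Fjbas j')) -big_mkcond big_nat1_eq /=.
  by have -> : (j0 < M)%N by apply: leq_ltn_trans jM; rewrite /j0; case: (e) => //;
    exact: leq_pred.
(* The partial sums are stationary at each b; the extension is their eventual value. *)
have ev b : exists n, exists M0, forall M, (M0 <= M)%N -> FM M b = n.
  elim: (gspan_all b) => [|c e j i v _ [n [M0 IH]]].
    exists 0; exists 0%N => M _; have := FMlin M (-1) 0 0.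
    by rewrite scaler0 addr0 scaleN1r => /eqP; rewrite addNr => /eqP.
  exists (c *: L e j i + n); exists (maxn j.+1 M0) => M; rewrite geq_max => /andP[jM MM].
  by rewrite FMlin FMbas ?IH.
have [F FE] := choice ev; exists F; split => [c u v|e j i].
  have [M1 E1] := FE (c *: u + v); have [M2 E2] := FE u; have [M3 E3] := FE v.
  pose M := maxn M1 (maxn M2 M3).
  by rewrite -(E1 M) -?(E2 M) -?(E3 M) ?FMlin ?leq_max ?leqnn ?orbT.
have [M1 E1] := FE (h ^+ i * gen e ^+ j); pose M := maxn M1 j.+1.
by rewrite -(E1 M) ?FMbas ?leq_max ?leqnn ?orbT.
Qed.
End Presentation.

(** * Multilinear cochains on sequences *)

(* An n-cochain is a function on sequences that vanishes off length n; the length is only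
   mentioned by [mlin]. *)
Section Cochains.
Variables (k : fieldType) (B : algType k).
Notation Y := (seq B -> B).
Implicit Types (f g : Y) (r b : B) (s t u : seq B).

Definition slice b f : Y := fun u => f (b :: u).
Definition lact r f : Y := fun s => r * f s.
(** With no argument present the bimodule is B itself, so the right action falls on the value. *)
Definition ract r f : Y := fun s => if s is b :: u then f (r * b :: u) else f [::] * r.
(** The Hochschild differential without its first face. The term [ract b f] is the face that
    multiplies [b] into the next argument, or into the value if there is none; the faces in the
    recursive call leave [b] alone. *)
Fixpoint bard_rec s f : B := if s is b :: t then - ract b f t - bard_rec t (slice b f) else 0.
Definition bard f : Y := fun s => bard_rec s f.

Lemma bard_cons f b t : bard f (b :: t) = - ract b f t - bard (slice b f) t.
Proof. by []. Qed.

Lemma slice_linear b : linear (slice b). Proof. by []. Qed.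
Lemma lact_linear r : linear (lact r).
Proof. by move=> c f g; apply/funext => s; rewrite /lact !fctE mulrDr scalerAr. Qed.
Lemma ract_linear r : linear (ract r).
Proof.
by move=> c f g; apply/funext => -[|b u] //; rewrite /ract !fctE mulrDl scalerAl.
Qed.
Lemma lactDr r f g : lact r (f + g) = lact r f + lact r g.
Proof. exact: (lfunD (lact_linear r)). Qed.
Lemma lactNr r f : lact r (- f) = - lact r f.
Proof. exact: (lfunN (lact_linear r)). Qed.
Lemma lactZr r c f : lact r (c *: f) = c *: lact r f.
Proof. exact: (lfunZ (lact_linear r)). Qed.
Lemma ractDr r f g : ract r (f + g) = ract r f + ract r g.
Proof. exact: (lfunD (ract_linear r)). Qed.
Lemma ractNr r f : ract r (- f) = - ract r f.
Proof. exact: (lfunN (ract_linear r)). Qed.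
Lemma ractZr r c f : ract r (c *: f) = c *: ract r f.
Proof. exact: (lfunZ (ract_linear r)). Qed.
Definition mul_linE := (lactDr, lactNr, lactZr, ractDr, ractNr, ractZr).
Lemma bard_linear : linear bard.
Proof.
move=> c f g; apply/funext => s; elim: s f g => [|b t IH] f g.
  by rewrite !fctE scaler0 addr0.
rewrite !fctE !bard_cons slice_linear IH ract_linear !fctE scalerBr scalerN.
by rewrite !opprD -!addrA; congr (_ + _); rewrite addrCA.
Qed.

Lemma lactA r r' f : lact r (lact r' f) = lact (r * r') f.
Proof. by apply/funext => s; rewrite /lact mulrA. Qed.
Lemma ractA r r' f : ract r (ract r' f) = ract (r' * r) f.
Proof. by apply/funext => -[|b u]; rewrite /ract mulrA. Qed.
Lemma lact1 f : lact 1 f = f.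
Proof. by apply/funext => s; rewrite /lact mul1r. Qed.
Lemma ract1 f : ract 1 f = f.
Proof. by apply/funext => -[|b u]; rewrite /ract ?mul1r ?mulr1. Qed.
Lemma lact_ract r r' f : lact r (ract r' f) = ract r' (lact r f).
Proof. by apply/funext => -[|b u]; rewrite /ract /lact ?mulrA. Qed.
Lemma lactD c r r' f : lact (c *: r + r') f = c *: lact r f + lact r' f.
Proof. by apply/funext => s; rewrite /lact !fctE mulrDl scalerAl. Qed.

Lemma slice_ract b c f : slice b (ract c f) = slice (c * b) f.
Proof. by apply/funext. Qed.
Lemma slice_lact b r f : slice b (lact r f) = lact r (slice b f).
Proof. by apply/funext. Qed.

Lemma bard_lact r f : bard (lact r f) = lact r (bard f).
Proof.
apply/funext => s; elim: s f => [|b t IH] f; first by rewrite /lact mulr0.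
by rewrite bard_cons -lact_ract slice_lact IH /lact bard_cons mulrBr mulrN.
Qed.
Lemma bard_ract r f : bard (ract r f) = ract r (bard f).
Proof.
apply/funext => -[|b t]; first by rewrite /ract mul0r.
by rewrite bard_cons ractA slice_ract [RHS]bard_cons.
Qed.
Lemma slice_bard b f : slice b (bard f) = - ract b f - bard (slice b f).
Proof. by apply/funext. Qed.

Lemma bard_bard f : bard (bard f) = 0.
Proof.
apply/funext => s; elim: s f => [|b t IH] f //.
rewrite bard_cons slice_bard (lfunB bard_linear) (lfunN bard_linear) bard_ract !fctE IH.
by rewrite oppr0 addr0 opprK addNr.
Qed.

(** The contracting homotopy of the rows: multiplying 1 into the next argument returns f. *)
Lemma bard_ins f : slice 1 (bard f) = - f - bard (slice 1 f).
Proof. by rewrite slice_bard ract1. Qed.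

Lemma bard_exact f : bard f = 0 -> f = bard (- slice 1 f).
Proof.
move=> f0; rewrite (lfunN bard_linear); apply/eqP; rewrite -subr_eq0 opprK -oppr_eq0 opprD.
by rewrite -bard_ins f0 (lfun0 (slice_linear 1)).
Qed.

Fixpoint mlin n f : Prop :=
  match n with
  | 0 => forall b u, f (b :: u) = 0
  | m.+1 => [/\ f [::] = 0, linear (fun b => slice b f) & forall b, mlin m (slice b f)]
  end.

Lemma mlin_lin n c f g : mlin n f -> mlin n g -> mlin n (c *: f + g).
Proof.
elim: n f g => [|n IH] f g /=.
  by move=> f0 g0 b u; rewrite !fctE f0 g0 scaler0 addr0.
move=> [f0 lf mf] [g0 lg mg]; split=> [|d u v|b]; last by rewrite slice_linear; apply: IH.
  by rewrite !fctE f0 g0 scaler0 addr0.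
rewrite !slice_linear lf lg !scalerDr !scalerA mulrC -!addrA; congr (_ + _).
by rewrite addrCA.
Qed.
Lemma mlin0 n : mlin n 0.
Proof. by elim: n => [|n IH] //=; split => // c u v; rewrite scaler0 addr0. Qed.
Lemma mlinD n f g : mlin n f -> mlin n g -> mlin n (f + g).
Proof. by move=> mf mg; rewrite -[f]scale1r; apply: mlin_lin. Qed.
Lemma mlinZ n c f : mlin n f -> mlin n (c *: f).
Proof. by move=> mf; rewrite -[_ *: _]addr0; apply: mlin_lin => //; apply: mlin0. Qed.
Lemma mlinN n f : mlin n f -> mlin n (- f).
Proof. by rewrite -scaleN1r; apply: mlinZ. Qed.
Lemma mlinB n f g : mlin n f -> mlin n g -> mlin n (f - g).
Proof. by move=> mf mg; apply/mlinD/mlinN. Qed.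
Lemma mlin_sum n (I : Type) (r : seq I) (F : I -> Y) :
  (forall i, mlin n (F i)) -> mlin n (\sum_(i <- r) F i).
Proof. by move=> mF; elim/big_ind: _ => //; [apply: mlin0 | apply: mlinD]. Qed.

Lemma mlin_lact n r f : mlin n f -> mlin n (lact r f).
Proof.
elim: n f => [|n IH] f /=; first by move=> f0 b u; rewrite /lact f0 mulr0.
move=> [f0 lf mf]; split=> [|d u v|b]; first by rewrite /lact f0 mulr0.
  by rewrite !slice_lact lf lact_linear.
by rewrite slice_lact; apply: IH.
Qed.
Lemma mlin_ract n r f : mlin n f -> mlin n (ract r f).
Proof.
case: n => [|n] /=; first by move=> f0 b u; rewrite /ract f0.
move=> [f0 lf mf]; split=> [|d u v|b]; first by rewrite /ract f0 mul0r.
  by rewrite !slice_ract mulrDr -scalerAr lf.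
by rewrite slice_ract.
Qed.
Lemma mlin_ractD n c r r' f : mlin n f -> ract (c *: r + r') f = c *: ract r f + ract r' f.
Proof.
move=> mf; apply/funext => -[|b u].
  by rewrite /ract !fctE mulrDr -scalerAr.
rewrite !fctE /ract; case: n mf => [|n] /= mf; first by rewrite !mf scaler0 addr0.
by rewrite mulrDl -scalerAl -[LHS]/(slice _ f u) (let: And3 _ lf _ := mf in lf).
Qed.
Lemma mlin_slice n f : mlin n f -> linear (fun b => slice b f).
Proof.
case: n => [|n] mf; last by case: mf.
have sl0 b : slice b f = 0 by apply/funext => t; rewrite /slice mf.
by move=> c u v; rewrite !sl0 scaler0 addr0.
Qed.
Lemma mlin_bard n f : mlin n f -> mlin n.+1 (bard f).
Proof.
elim: n f => [|n IH] f mf; split => [//|d u v|b]; rewrite !slice_bard.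
- rewrite (mlin_slice mf) bard_linear (mlin_ractD d u v mf) scalerBr scalerN !opprD.
  by rewrite -!addrA; congr (_ + _); rewrite addrCA.
- have -> : slice b f = 0 by apply/funext => t; rewrite /slice mf.
  by rewrite (lfun0 bard_linear); apply: mlinB (mlin0 0); apply/mlinN/mlin_ract.
- rewrite (mlin_slice mf) bard_linear (mlin_ractD d u v mf) scalerBr scalerN !opprD.
  by rewrite -!addrA; congr (_ + _); rewrite addrCA.
- by apply: mlinB; [apply/mlinN/mlin_ract | apply: IH; case: mf => _ _; apply].
Qed.

(* [aug f] is the left linear extension of f to B (x) B^n, the augmentation of the columns. *)
Definition aug f : Y := fun s => if s is b :: t then b * f t else 0.
Lemma aug_linear : linear aug.
Proof.
move=> c f g; apply/funext => -[|b t]; rewrite !fctE /aug ?scaler0 ?addr0 //.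
by rewrite mulrDr scalerAr.
Qed.
Lemma aug_inj f : aug f = 0 -> f = 0.
Proof. by move=> /(congr1 (slice 1)) e; rewrite -[f]lact1; exact: e. Qed.
Lemma slice_aug b f : slice b (aug f) = lact b f.
Proof. by apply/funext. Qed.
Lemma mlin_aug n f : mlin n f -> mlin n.+1 (aug f).
Proof.
by move=> mf; split=> [//|c u v|b]; rewrite !slice_aug; [exact: lactD | exact: mlin_lact].
Qed.

(** [aug f] is the first face, which [bard] omits; the sum is the full Hochschild differential. *)
Definition hochd f : Y := aug f + bard f.
Lemma hochd_linear : linear hochd.
Proof. by move=> c f g; rewrite /hochd aug_linear bard_linear scalerDr addrACA. Qed.
(** Up to sign, [aug] is thus a morphism from the Hochschild complex to the complex with
    differential [bard]. *)
Lemma bard_aug f : bard (aug f) = - aug (hochd f).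
Proof.
apply/funext => -[|b t]; first by rewrite !fctE /= oppr0.
rewrite bard_cons slice_aug bard_lact !fctE /= /lact mulrDr opprD; congr (- _ - _).
by case: t => [|c t]; rewrite /ract /aug /= ?mul0r ?mulr0 ?mulrA.
Qed.
Lemma mlin_hochd n f : mlin n f -> mlin n.+1 (hochd f).
Proof. by move=> mf; apply: mlinD; [exact: mlin_aug | exact: mlin_bard]. Qed.

End Cochains.

(** * Comparison with the cochains of the statement *)

(** The quotient Z / N has dimension m, phrased as in [HH_dim] so that it can be carried from one
    complex to another. *)
Definition qdim (k : fieldType) (X : lmodType k) (Z N : X -> Prop) (m : nat) : Prop :=
  exists c : 'I_m -> X,
    [/\ forall j, Z (c j),
        forall f, Z f -> exists coef : 'I_m -> k, N (f - \sum_(j < m) coef j *: c j)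
      & forall coef : 'I_m -> k, N (\sum_(j < m) coef j *: c j) -> forall j, coef j = 0].

Section Bar.
Variables (k : fieldType) (B : algType k).
Notation Y := (seq B -> B).
Implicit Types (f g : Y) (s t : seq B).

Lemma mlin_size n f s : mlin n f -> size s != n -> f s = 0.
Proof.
elim: n f s => [|n IH] f [|b s] /= mf sn; rewrite ?eqxx // in sn *.
- by case: mf.
- by case: mf => _ _ mf; apply: (IH (slice b f)).
Qed.

Lemma mlin_cat n f : mlin n f ->
  forall s1 s2 c v w, f (s1 ++ (c *: v + w) :: s2) = c *: f (s1 ++ v :: s2) + f (s1 ++ w :: s2).
Proof.
elim: n f => [|n IH] f /=.
  move=> f0 [|b s1] s2 c v w; rewrite /= !f0 scaler0 addr0 //.
move=> [_ lf mf] [|b s1] s2 c v w /=; last exact: (IH (slice b f)).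
by rewrite -[LHS]/(slice _ f s2) lf.
Qed.

Lemma mlin_of_cat n f : (forall s, size s != n -> f s = 0) ->
  (forall s1 s2 c v w, f (s1 ++ (c *: v + w) :: s2) = c *: f (s1 ++ v :: s2) + f (s1 ++ w ::
    s2)) ->
  mlin n f.
Proof.
elim: n f => [|n IH] f f0 lf /=; first by move=> b u; apply: f0.
split=> [|c v w|b]; first exact: f0.
  by apply/funext => u; exact: (lf [::]).
apply: IH => [s sn|s1 s2 c v w]; first exact: f0.
exact: (lf (b :: s1)).
Qed.

Definition to_cochain n f : cochain B n := fun u => f (codom u).
Definition of_cochain n (f : cochain B n) : Y :=
  fun s => if size s == n then f (tup n (nth 0 s)) else 0.

Lemma codom_tup n (g : nat -> B) : codom (tup n g) = mkseq g n.
Proof.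
rewrite /codom /image_mem /mkseq -val_enum_ord -map_comp.
by apply: eq_map => i /=; rewrite ffunE.
Qed.

Lemma nth_codomE n (u : {ffun 'I_n -> B}) (i : 'I_n) : nth 0 (codom u) i = u i.
Proof. by rewrite codom_ffun nth_fgraph_ord. Qed.

Lemma get_codom n (u : {ffun 'I_n.+1 -> B}) m : (m < n.+1)%N -> get u m = nth 0 (codom u) m.
Proof. by move=> mn; rewrite /get -nth_codomE inordK. Qed.

Lemma tup_codom n (u : {ffun 'I_n -> B}) : tup n (nth 0 (codom u)) = u.
Proof. by apply/ffunP => i; rewrite ffunE nth_codomE. Qed.

Lemma of_cochainK n (f : cochain B n) u : to_cochain (of_cochain f) u = f u.
Proof. by rewrite /to_cochain /of_cochain size_codom card_ord eqxx tup_codom. Qed.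

Lemma codom_upd n (u : {ffun 'I_n -> B}) i v :
  codom (upd u i v) = take i (codom u) ++ v :: drop i.+1 (codom u).
Proof.
have sz (w : {ffun 'I_n -> B}) : size (codom w) = n by rewrite size_codom card_ord.
have le_in : (i <= n)%N := ltnW (ltn_ord i).
have szr : size (take i (codom u) ++ v :: drop i.+1 (codom u)) = n.
  by rewrite size_cat size_take /= size_drop sz ltn_ord; have := ltn_ord i; lia.
apply: (@eq_from_nth _ 0) => [|m]; first by rewrite szr sz.
rewrite sz => mn; rewrite -[m]/(val (Ordinal mn)) nth_codomE ffunE nth_cat size_take sz ltn_ord.
rewrite -val_eqE /=; case: ltngtP => mi.
- by rewrite nth_take // -[m]/(val (Ordinal mn)) nth_codomE.
- have -> : (m - i)%N = (m - i).-1.+1 by lia.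
  rewrite /= nth_drop -[u _]nth_codomE /=; congr nth; lia.
- by rewrite mi subnn.
Qed.

Lemma to_cochain_multilinear n f : mlin n f -> multilinear (@to_cochain n f).
Proof. by move=> mf i u c v w; rewrite /to_cochain !codom_upd (mlin_cat mf). Qed.

Lemma of_cochain_mlin n (f : cochain B n) : multilinear f -> mlin n (of_cochain f).
Proof.
move=> mf; apply: mlin_of_cat => [s|s1 s2 c v w]; first by rewrite /of_cochain => /negbTE ->.
rewrite /of_cochain !size_cat /=; case: eqP => [sz|_]; last by rewrite scaler0 addr0.
have i_lt : (size s1 < n)%N by lia.
pose i := Ordinal i_lt; pose u0 : {ffun 'I_n -> B} := tup n (nth 0 (s1 ++ 0 :: s2)).
have updE z : tup n (nth 0 (s1 ++ z :: s2)) = upd u0 i z.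
  apply/ffunP => m; rewrite !ffunE -val_eqE /= !nth_cat.
  case: ltngtP => // mi; last by rewrite mi subnn.
  by have -> : (m - size s1)%N = (m - size s1).-1.+1 by lia.
by rewrite !updE mf.
Qed.

Lemma bard_sum n f s : size s = n.+1 ->
  bard f s = \sum_(i < n) (-1) ^+ i.+1 *
       f (mkseq (fun m => if (m < i)%N then nth 0 s m
                          else if m == i then nth 0 s i * nth 0 s i.+1
                          else nth 0 s m.+1) n)
  + (-1) ^+ n.+1 * (f (mkseq (nth 0 s) n) * nth 0 s n).
Proof.
elim: n s f => [|n IH] [|b t] f // [szt]; rewrite bard_cons.
  by case: t szt => // _; rewrite big_ord0 /bard /= subr0 expr1 mulN1r add0r.
(* The summand of index 0 is the face split off by the recursion; the others move by one place,
   which accounts for the sign. *)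
rewrite IH // big_ord_recl opprD -addrA; congr (_ + _).
  case: t szt => // c t szt; rewrite expr1 mulN1r /ract; congr (- f _).
  rewrite -[_ :: t in LHS](mkseq_nth 0) [size _]szt; apply/eq_in_map => m; rewrite mem_iota /=.
  by case: m.
rewrite -sumrN; congr (_ + _).
  apply: eq_bigr => i _; rewrite [in RHS]exprS mulN1r mulNr; congr (- (_ * f _)).
  rewrite /mkseq /= -(addn0 1%N) iotaDl -map_comp; congr cons.
rewrite [in RHS]exprS mulN1r mulNr; congr (- (_ * (f _ * _))).
by rewrite /mkseq /= -(addn0 1%N) iotaDl -map_comp.
Qed.

Lemma hoch_d_to_cochain n f (u : {ffun 'I_n.+1 -> B}) : hoch_d (@to_cochain n f) u = hochd f
  (codom u).
Proof.
have su : size (codom u) = n.+1 by rewrite size_codom card_ord.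
rewrite /hoch_d /hochd fctE (bard_sum f su) addrA; congr (_ + _ + _).
- rewrite get_codom // /to_cochain codom_tup.
  case: (codom u) su (@get_codom n u) => // b t [st] gE /=; congr (_ * f _).
  rewrite -[RHS](mkseq_nth 0) st; apply/eq_in_map => m; rewrite mem_iota add0n => /andP[_ mn].
  by rewrite gE.
- apply: eq_bigr => i _; congr (_ * _); rewrite /to_cochain codom_tup; congr f.
  apply/eq_in_map => m; rewrite mem_iota add0n => /andP[_ mn].
  have := ltn_ord i => i_n.
  by rewrite !get_codom //; lia.
- rewrite get_codom // /to_cochain codom_tup; congr (_ * (f _ * _)).
  apply/eq_in_map => m; rewrite mem_iota add0n => /andP[_ mn].
  by rewrite get_codom //; lia.
Qed.

Definition barZ n f := mlin n f /\ hochd f = 0.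
Definition barN n f := if n is m.+1 then exists2 g, mlin m g & f = hochd g else f = 0.

Lemma of_cochain_eq n f (F : cochain B n) : mlin n f -> (forall u : {ffun 'I_n -> B},
  f (codom u) = F u) -> f = of_cochain F.
Proof.
move=> mf fF; apply/funext => s; rewrite /of_cochain; case: eqP => [sz|/eqP/(mlin_size mf)//].
by rewrite -fF codom_tup -sz mkseq_nth.
Qed.

(** [to_cochain] and [of_cochain] match cocycles and coboundaries. As multilinear cochains vanish
    off their length, pointwise identities on tuples become equalities of functions on sequences. *)
Lemma HH_dim_of_bar n m : qdim (barZ n) (barN n) m -> HH_dim B n m.
Proof.
move=> [c [cZ cspan cfree]]; exists (fun j => @to_cochain n (c j)); split.
- move=> j; have [mc dc] := cZ j; split; first exact: to_cochain_multilinear.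
  by move=> u; rewrite hoch_d_to_cochain dc.
- move=> f [mf df]; have mof := of_cochain_mlin mf.
  have [|coef] := cspan (of_cochain f).
    split=> //; apply/funext => s; have [sz|sz] := eqVneq (size s) n.+1; last first.
      by rewrite (mlin_size (mlin_hochd mof)).
    have -> : s = codom (tup n.+1 (nth 0 s)) by rewrite codom_tup -sz mkseq_nth.
    by rewrite -hoch_d_to_cochain (_ : to_cochain (of_cochain f) = f) //; apply/funext => u;
      rewrite of_cochainK.
  move=> Nf; exists coef.
  have fE u : f u - \sum_(j < m) coef j *: to_cochain (c j) u =
      (of_cochain f - \sum_(j < m) coef j *: c j) (codom u).
    by rewrite -[f u]of_cochainK !fctE fct_sumE.
  case: n f c cZ cspan cfree mf df mof Nf fE => [|n] f c cZ cspan cfree mf df mof /=.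
    by move=> -> fE u; rewrite fE.
  move=> [g mg ->] fE; exists (to_cochain g); split; first exact: to_cochain_multilinear.
  by move=> u; rewrite fE hoch_d_to_cochain.
- move=> coef; have msum : mlin n (\sum_(j < m) coef j *: c j).
    by apply: mlin_sum => j; apply: mlinZ; case: (cZ j).
  move=> Nf; apply: cfree; case: n c cZ cspan msum Nf => [|n] c cZ cspan msum /=.
    move=> f0; rewrite (of_cochain_eq (F := fun=> 0) msum); first by apply/funext => s;
      rewrite /of_cochain; case: ifP.
    by move=> u; rewrite fct_sumE -[RHS](f0 u).
  move=> [g [mg fE]]; exists (of_cochain g); first exact: of_cochain_mlin.
  have md := mlin_hochd (of_cochain_mlin mg).
  rewrite (of_cochain_eq (F := hoch_d g) msum) => [|u]; last by rewrite fct_sumE -fE.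
  apply/esym/of_cochain_eq => // u; rewrite -hoch_d_to_cochain.
  by rewrite (_ : to_cochain (of_cochain g) = g) //; apply/funext => w; rewrite of_cochainK.
Qed.

End Bar.

(** * The small complex *)

(* [F e] is the value on the alternating word of length q with last letter [gen e]; the letter
   that may be put in front of this word is [gen (pre e q)]. For q = 0 there is a single empty
   word, hence the symmetry conditions in [grid]. *)
Section SmallComplex.
Variables (k : fieldType) (a : {poly k}) (h0 : k) (B : algType k) (h x y : B).
Hypothesis HB : is_GWA a h0 h x y.
Notation Y := (seq B -> B).
Notation G := (bool -> bool -> Y).
Notation gen := (gen x y).
Notation hshift := (hshift h0 h).
Notation aval := (aval a h0 h).
Implicit Types (e t : bool) (q n : nat) (F : bool -> Y) (f g : Y).

Definition pre e q := e (+) odd q.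
Lemma preS e q : pre e q.+1 = ~~ pre e q.
Proof. by rewrite /pre /= addbN. Qed.
Lemma preN e q : pre (~~ e) q = pre e q.+1.
Proof. by rewrite /pre /= addbN addNb. Qed.

(** The word of length q + 1 ending in [gen e] loses its first letter, [gen (pre e q)], leaving the
    word that ends in [gen e], or its last letter, leaving the one that ends in [gen (~~ e)]. *)
Definition wordd q F : bool -> Y :=
  fun e => lact (gen (pre e q)) (F e) + (-1) ^+ q.+1 *: ract (gen e) (F (~~ e)).
(** By [gen_hshift], moving [hshift e] leftwards across the word of length q turns it into
    [hshift (pre e q)]. This is the commutator with h adapted to the word. *)
Definition adh q F : bool -> Y := fun e => lact (hshift (pre e q)) (F e) - ract (hshift e) (F
  e).
(* The divided difference (a(u) - a(v)) / (u - v), where u = hshift (pre e q) acts on the left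
   and v = hshift e on the right. *)
Definition divd q F : bool -> Y := fun e =>
  \sum_(i < size a) a`_i *: \sum_(m < i)
    lact (hshift (pre e q) ^+ (i - m.+1)) (ract (hshift e ^+ m) (F e)).

Lemma wordd_linear q : linear (wordd q).
Proof.
move=> c F F'; apply/funext => e;
  rewrite /wordd !fappE lact_linear ract_linear !scalerDr !scalerA.
by rewrite mulrC addrACA.
Qed.
Lemma adh_linear q : linear (adh q).
Proof.
move=> c F F'; apply/funext => e; rewrite /adh !fappE lact_linear ract_linear opprD addrACA.
by rewrite -scalerBr.
Qed.
Lemma divd_linear q : linear (divd q).
Proof.
move=> c F F'; apply/funext => e; rewrite /divd !fappE scaler_sumr -big_split /=.
apply: eq_bigr => i _; rewrite scalerA mulrC -scalerA -scalerDr; congr (_ *: _).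
by rewrite scaler_sumr -big_split /=; apply: eq_bigr => m _; rewrite ract_linear lact_linear.
Qed.

Definition mlinF n F := forall e, mlin n (F e).
Lemma mlinF_wordd n q F : mlinF n F -> mlinF n (wordd q F).
Proof. by move=> mF e; apply: mlinD; [apply: mlin_lact | apply/mlinZ/mlin_ract]. Qed.
Lemma mlinF_adh n q F : mlinF n F -> mlinF n (adh q F).
Proof. by move=> mF e; apply: mlinB; [apply: mlin_lact | apply/mlin_ract]. Qed.
Lemma mlinF_divd n q F : mlinF n F -> mlinF n (divd q F).
Proof. by move=> mF e; apply: mlin_sum => i; apply/mlinZ/mlin_sum => m;
  apply/mlin_lact/mlin_ract. Qed.

Lemma wordd_adh q F : adh q.+1 (wordd q F) = wordd q (adh q F).
Proof.
apply/funext => e; rewrite /adh /wordd !mul_linE -!lact_ract !lactA !ractA.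
by rewrite preN preS !(gen_hshift HB) opprD addrACA -scalerBr.
Qed.

Lemma gen_hshiftX e n : gen e * hshift e ^+ n = hshift (~~ e) ^+ n * gen e.
Proof. exact: comm_expr (gen_hshift HB e). Qed.

Lemma wordd_divd q F : wordd q.+2 (divd q F) = divd q.+1 (wordd q F).
Proof.
apply/funext => e; rewrite /wordd {1 2}/divd !(lfun_sum (lact_linear _)) !(lfun_sum
  (ract_linear _)).
rewrite scaler_sumr -big_split; apply: eq_bigr => i _ /=.
rewrite !mul_linE scalerA [_ * a`_i]mulrC -scalerA -scalerDr; congr (_ *: _).
rewrite !(lfun_sum (lact_linear _)) !(lfun_sum (ract_linear _)).
rewrite scaler_sumr -big_split; apply: eq_bigr => m _ /=.
rewrite !mul_linE -!lact_ract !lactA !ractA !preN !preS !negbK !gen_hshiftX.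
by rewrite !exprS !mulN1r opprK.
Qed.

Lemma adh_divd q F : adh q.+2 (divd q F) = divd q (adh q F).
Proof.
apply/funext => e; rewrite /adh /divd !(lfun_sum (lact_linear _)) !(lfun_sum (ract_linear _)).
rewrite -sumrB; apply: eq_bigr => i _ /=.
rewrite !mul_linE -scalerBr; congr (_ *: _).
rewrite !(lfun_sum (lact_linear _)) !(lfun_sum (ract_linear _)).
rewrite -sumrB; apply: eq_bigr => m _ /=.
rewrite !mul_linE -!lact_ract !lactA !ractA !preS !negbK.
by rewrite -exprS exprSr -exprS exprSr.
Qed.

Lemma lact_linearl f : linear (fun r => lact r f).
Proof. by move=> c u v; rewrite lactD. Qed.

Lemma ract_linearl n f : mlin n f -> linear (fun r => ract r f).
Proof. by move=> mf c u v; rewrite (mlin_ractD _ _ _ mf). Qed.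

(** The sum for u^i - v^i telescopes after multiplication of the divided difference by u - v. *)
Lemma divd_adh n q F : mlinF n F ->
  divd q (adh q F) = fun e => lact (aval (pre e q)) (F e) - ract (aval e) (F e).
Proof.
move=> mF; apply/funext => e.
rewrite /aval /peval (lfun_sum (lact_linearl (F e))) (lfun_sum (ract_linearl (mF e))) -sumrB
  /divd.
apply: eq_bigr => i _.
rewrite (lfunZ (lact_linearl (F e))) (lfunZ (ract_linearl (mF e))) -scalerBr; congr (_ *: _).
set u := hshift (pre e q); set v := hshift e.
pose g m := - lact (u ^+ (i - m)) (ract (v ^+ m) (F e)).
transitivity (\sum_(0 <= m < i) (g m.+1 - g m)).
  rewrite big_mkord; apply: eq_bigr => m _;
    rewrite /g /adh opprK addrC !mul_linE -!lact_ract !lactA !ractA.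
  by rewrite -exprSr -exprS -subSn // subSS.
by rewrite telescope_sumr // /g subnn subn0 !expr0 lact1 ract1 opprK addrC.
Qed.

(** The mixed terms cancel and adjacent letters multiply to a. What is left is a commutator with a,
    which need not vanish; writing it through the commutator with h is the reason for [divd] in
    [vdiff]. *)
Lemma wordd_wordd n q F : mlinF n F -> wordd q.+1 (wordd q F) = divd q (adh q F).
Proof.
move=> mF; rewrite (divd_adh _ mF); apply/funext => e; rewrite /wordd !mul_linE -!lact_ract.
rewrite !lactA !ractA negbK preN preS !(gen_gen HB).
rewrite scalerDr !scalerA -!addrA; congr (_ + _).
rewrite addrA [_ ^+ q.+2]exprS mulN1r -scalerDl subrr scale0r add0r mulNr -expr2 sqrr_sign.
by rewrite scaleN1r.
Qed.

(* [phi false] lives on the words of length q and [phi true] on the symbols h w with w of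
   length q - 1 (so it is 0 when q = 0). *)
Definition vdiff q (phi : G) : G := fun t =>
  if t then adh q (phi false) - wordd q.-1 (phi true)
  else wordd q (phi false) - divd q.-1 (phi true).

(** The last two conditions express that there is one empty word in degree 0 and one symbol h in
    degree 1. The number n of arguments is the index of the column. *)
Definition grid n q (phi : G) : Prop :=
  [/\ forall t, mlinF n (phi t),
      q = 0%N -> phi true = 0 /\ phi false true = phi false false
    & q = 1%N -> phi true true = phi true false].

Lemma vdiff_linear q : linear (vdiff q).
Proof.
move=> c f g; apply/funext => -[]; rewrite /vdiff !fappE /=.
- by rewrite adh_linear wordd_linear [in RHS]scalerBr opprD addrACA.
- by rewrite wordd_linear divd_linear [in RHS]scalerBr opprD addrACA.
Qed.

Lemma grid_vdiff n q phi : grid n q phi -> grid n q.+1 (vdiff q phi).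
Proof.
move=> [mphi phi0 phi1]; split=> // [[]|[q0]].
- by move=> e; exact: mlinB (mlinF_adh q (mphi _) e) (mlinF_wordd _ (mphi _) e).
- by move=> e; exact: mlinB (mlinF_wordd q (mphi _) e) (mlinF_divd _ (mphi _) e).
have [p0 ps] := phi0 q0; rewrite q0 /vdiff p0 (lfun0 (wordd_linear _)) !fappE !subr0 /adh ps.
set f := phi false false; have mf : mlin n f := mphi false false.
(* On the empty word the scalar shift cancels in the commutator, so both components agree. *)
have hsE e : lact (hshift e) f - ract (hshift e) f = lact h f - ract h f.
  rewrite /hshift; set c := if e then _ else _.
  rewrite (lfunB (lact_linearl f)) (lfunB (ract_linearl mf)) (lfunZ (lact_linearl f)).
  by rewrite (lfunZ (ract_linearl mf)) lact1 ract1 opprB addrA subrK.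
by rewrite /pre /= !hsE.
Qed.

Lemma vdiff_vdiff n q phi : grid n q phi -> vdiff q.+1 (vdiff q phi) = 0.
Proof.
move=> [mphi phi0 _]; have m0 := mphi false; have m1 := mphi true.
(* For q = 0 the index [q.-1] is a default value, harmless because [phi true] is then 0. *)
case: q phi0 => [|q] phi0; apply/funext => -[]; rewrite /vdiff /= !fappE.
- have [-> _] := phi0 erefl.
  by rewrite (lfun0 (wordd_linear _)) (lfun0 (divd_linear _)) !subr0 wordd_adh subrr.
- have [-> _] := phi0 erefl.
  rewrite (lfun0 (wordd_linear _)) (lfun0 (divd_linear _)) !subr0.
  by rewrite (wordd_wordd _ m0) subrr.
- rewrite (lfunB (adh_linear _)) (lfunB (wordd_linear _)) adh_divd wordd_adh (wordd_wordd _ m1).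
  by rewrite subrr.
- rewrite (lfunB (divd_linear _)) (lfunB (wordd_linear _)) wordd_divd (wordd_wordd _ m0).
  by rewrite subrr.
Qed.

Definition hdiff (phi : G) : G := fun t e => bard (phi t e).
Lemma hdiff_linear : linear hdiff.
Proof. by move=> c f g; apply/funext => t; apply/funext => e;
  rewrite /hdiff !fappE bard_linear. Qed.
Lemma grid_hdiff n q phi : grid n q phi -> grid n.+1 q (hdiff phi).
Proof.
move=> [mphi phi0 phi1]; split=> [t e|q0|q1]; first exact: (mlin_bard (mphi t e)).
  have [p0 ps] := phi0 q0; rewrite /hdiff p0 ps; split=> //.
  by apply/funext => e; rewrite !fappE (lfun0 (@bard_linear _ _)).
by rewrite /hdiff phi1.
Qed.
Lemma hdiff_wordd q F : wordd q (fun e => bard (F e)) = fun e => bard (wordd q F e).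
Proof.
by apply/funext => e; rewrite /wordd (lfunD (@bard_linear _ _)) (lfunZ (@bard_linear _ _))
  bard_lact bard_ract.
Qed.
Lemma hdiff_adh q F : adh q (fun e => bard (F e)) = fun e => bard (adh q F e).
Proof. by apply/funext => e; rewrite /adh (lfunB (@bard_linear _ _)) bard_lact bard_ract. Qed.
Lemma hdiff_divd q F : divd q (fun e => bard (F e)) = fun e => bard (divd q F e).
Proof.
apply/funext => e; rewrite /divd (lfun_sum (@bard_linear _ _)); apply: eq_bigr => i _.
rewrite (lfunZ (@bard_linear _ _)) (lfun_sum (@bard_linear _ _)); congr (_ *: _).
by apply: eq_bigr => m _; rewrite bard_lact bard_ract.
Qed.
Lemma hdiff_vdiff q phi : hdiff (vdiff q phi) = vdiff q (hdiff phi).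
Proof.
apply/funext => -[]; apply/funext => e; rewrite /hdiff /vdiff !fappE (lfunB (@bard_linear _ _)).
  by rewrite hdiff_adh hdiff_wordd.
by rewrite hdiff_wordd hdiff_divd.
Qed.
Lemma hdiff_hdiff phi : hdiff (hdiff phi) = 0.
Proof. by apply/funext => t; apply/funext => e; rewrite /hdiff bard_bard. Qed.

Lemma hdiff_exact n q phi : grid n.+1 q phi -> hdiff phi = 0 -> exists2 psi,
  grid n q psi & hdiff psi = phi.
Proof.
move=> [mphi phi0 phi1] dphi; exists (fun t e => - slice 1 (phi t e)).
  split=> [t e|/phi0[-> ->]|/phi1 ->] //; first by apply: mlinN; case: (mphi t e) => _ _; apply.
  by split=> //; apply/funext => e; rewrite !fappE (lfun0 (slice_linear 1)) oppr0.
apply/funext => t; apply/funext => e; apply/esym/bard_exact.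
by rewrite -[LHS]/(hdiff phi t e) dphi.
Qed.

(** In column 0 inserting 1 gives zero, so exactness of the row means injectivity. *)
Lemma hdiff_inj q phi : grid 0 q phi -> hdiff phi = 0 -> phi = 0.
Proof.
move=> [mphi _ _] dphi; apply/funext => t; apply/funext => e.
rewrite (bard_exact (f := phi t e)); last by rewrite -[LHS]/(hdiff phi t e) dphi.
have -> : slice 1 (phi t e) = 0 by apply/funext => s; apply: (mphi t e).
by rewrite oppr0 (lfun0 (@bard_linear _ _)).
Qed.

End SmallComplex.

(** * Exactness of the columns *)

Section Columns.
Variables (k : fieldType) (a : {poly k}) (h0 : k) (B : algType k) (h x y : B).
Hypothesis HB : is_GWA a h0 h x y.
Notation Y := (seq B -> B).
Notation G := (bool -> bool -> Y).
Notation gen := (gen x y).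
Notation hshift := (hshift h0 h).
Notation aval := (aval a h0 h).
Notation wordd := (wordd x y).
Notation adh := (adh h0 h).
Notation vdiff := (vdiff a h0 h x y).
Implicit Types (e t : bool) (q n : nat) (F : bool -> Y) (f g : Y).

Lemma exists_mlin n (L : bool -> nat -> nat -> Y) :
  (forall e j i, mlin n (L e j i)) -> L true 0%N =1 L false 0%N ->
  exists2 f, mlin n.+1 f & forall e j i, slice (h ^+ i * gen e ^+ j) f = L e j i.
Proof.
move=> mL L0; have [F [lF FE]] := exists_linear_ext HB L0.
exists (fun s => if s is b :: u then F b u else 0); last exact: FE.
split=> // b; rewrite -[slice _ _]/(F b).
elim: (gspan_all HB b) => [|c e j i v _ IH]; first by rewrite (lfun0 lF); apply: mlin0.
by rewrite lF FE; apply: mlin_lin.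
Qed.

Lemma mlin_ext n f g : mlin n.+1 f -> mlin n.+1 g ->
  (forall e j i, slice (h ^+ i * gen e ^+ j) f = slice (h ^+ i * gen e ^+ j) g) -> f = g.
Proof.
move=> [f0 lf _] [g0 lg _] fg; apply/funext => -[|b u]; first by rewrite f0 g0.
by rewrite -[LHS]/(slice b f u) (linear_ext HB lf lg fg).
Qed.

(** The scalar in [hshift e] is moved from the right action to the left one, so that the right
    action is by h alone and recursion on powers of h applies. *)
Definition shift_gap i e : B := hshift i + (if e then 0 else h0)%:A.
Notation u := shift_gap.

Lemma adhE n i e f : mlin n f -> lact (hshift i) f - ract (hshift e) f = lact (u i e) f - ract
  h f.
Proof.
move=> mf; rewrite /u (lfunD (lact_linearl f) (hshift i)) (lfunB (ract_linearl mf) h).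
by rewrite (lfunZ (lact_linearl f)) (lfunZ (ract_linearl mf)) lact1 ract1 opprB addrA.
Qed.

Lemma shift_gap_diag e : u e e = h.
Proof. by rewrite /u /hshift subrK. Qed.

(** On a first argument h^l b the equation reads f(h^(l+1) b) = u f(h^l b) - g(h^l b), with u =
    [shift_gap i e]; it is solved by recursion on l from the value 0. *)
Lemma adh1_surj n i e g : mlin n.+1 g ->
  exists2 f, mlin n.+1 f & lact (hshift i) f - ract (hshift e) f = g.
Proof.
move=> mg; have [_ _ mgs] := mg.
pose L e' j m : Y := nat_rect (fun=> Y) 0
  (fun l X => lact (u i e) X - slice (h ^+ l * gen e' ^+ j) g) m.
have [e' j m||f mf fE] := @exists_mlin n L; last exists f => //.
- by elim: m => [|m IH]; [exact: mlin0 | exact: mlinB (mlin_lact _ IH) (mgs _)].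
- by move=> m; elim: m => [|m IH] //=; rewrite IH !expr0.
apply: mlin_ext (mlinB (mlin_lact _ mf) (mlin_ract _ mf)) mg _ => e' j m.
rewrite (adhE _ _ mf) (lfunB (slice_linear _)) slice_lact slice_ract mulrA -exprS !fE /=.
by rewrite opprB addrC subrK.
Qed.

Lemma adh_surj n q F : mlinF n.+1 F -> (q = 0%N -> F true = F false) ->
  exists2 X, mlinF n.+1 X & adh q X = F /\ (q = 0%N -> X true = X false).
Proof.
move=> mF; case: q => [|q] sF.
  (* In length 0 the commutator does not depend on [e], so one preimage serves both indices. *)
  have [f mf fE] := adh1_surj true true (mF true).
  exists (fun=> f); first by move=> e.
  split=> //; apply/funext => e; rewrite /adh /pre /= addbF (adhE _ _ mf).
  by move: fE; rewrite (adhE _ _ mf) !shift_gap_diag => ->; case: e; rewrite ?sF.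
have [f1 mf1 f1E] := adh1_surj (pre true q.+1) true (mF true).
have [f2 mf2 f2E] := adh1_surj (pre false q.+1) false (mF false).
exists (fun e => if e then f1 else f2); first by case.
by split=> //; apply/funext => -[].
Qed.

Definition intertwines i e f := lact (hshift i) f = ract (hshift e) f.

Lemma intertwines_h n i e f b m : mlin n f -> intertwines i e f ->
  slice (h ^+ m * b) f = lact (u i e ^+ m) (slice b f).
Proof.
move=> mf fc; have {}fc : lact (u i e) f = ract h f.
  by apply/eqP; rewrite -subr_eq0 -(adhE _ _ mf) fc subrr.
elim: m => [|m IH]; first by rewrite !expr0 mul1r lact1.
by rewrite exprS -mulrA -slice_ract -fc slice_lact IH lactA -exprS.
Qed.

Lemma intertwines_aval n i e f : mlin n f -> intertwines i e f ->
  ract (aval e) f = lact (aval i) f.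
Proof.
move=> mf fc; rewrite /aval /peval (lfun_sum (lact_linearl f)) (lfun_sum (ract_linearl mf)).
apply: eq_bigr => m _; rewrite (lfunZ (lact_linearl f)) (lfunZ (ract_linearl mf));
  congr (_ *: _).
elim: (nat_of_ord m) => [|l IH]; first by rewrite !expr0 lact1 ract1.
by rewrite exprSr -ractA IH -lact_ract -fc lactA -exprSr.
Qed.

Lemma intertwines_ext n i e f g : mlin n.+1 f -> mlin n.+1 g ->
  intertwines i e f -> intertwines i e g ->
  (forall e' j, slice (gen e' ^+ j) f = slice (gen e' ^+ j) g) -> f = g.
Proof.
move=> mf mg cf cg fg; apply: (mlin_ext mf mg) => e' j m.
by rewrite (intertwines_h _ _ mf cf) (intertwines_h _ _ mg cg) fg.
Qed.

(** Elements of the kernel of [adh] are determined by their values at powers of a letter, as in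
    [intertwines_ext]; those values can be prescribed freely, up to agreement at the power 0. *)
Lemma exists_intertwiner n i e (L : bool -> nat -> Y) :
  (forall e' j, mlin n (L e' j)) -> L true 0%N = L false 0%N ->
  exists f, [/\ mlin n.+1 f, intertwines i e f & forall e' j, slice (gen e' ^+ j) f = L e' j].
Proof.
move=> mL L0; have [e' j m|m|f mf fE] := @exists_mlin n (fun e' j m => lact (u i e ^+ m) (L e'
  j)).
- exact: mlin_lact.
- by rewrite L0.
exists f; split=> [//||e' j]; last by have := fE e' j 0%N; rewrite !expr0 mul1r lact1.
apply/eqP; rewrite -subr_eq0 (adhE _ _ mf); apply/eqP.
apply: (mlin_ext (mlinB (mlin_lact (u i e) mf) (mlin_ract h mf)) (mlin0 B n.+1)) => e' j m.
by rewrite (lfunB (slice_linear _)) slice_lact slice_ract mulrA -exprS !fE lactA -exprS subrr.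
Qed.

(** On a cocycle in degree 0 the left and right actions of h, x and y agree, so its value at a first
    argument b is b times its value at 1. *)
Lemma vdiff_exact0 n phi : grid n.+1 0 phi -> vdiff 0 phi = 0 ->
  exists2 f, mlin n f & phi = fun t e => if t then 0 else aug f.
Proof.
move=> [mphi /(_ erefl)[phi0 phis] _] dphi.
have [_ _ ms] := mphi false true.
exists (slice 1 (phi false true)); first exact: ms.
apply/funext => -[]; apply/funext => e; first by rewrite phi0.
have pe e' : phi false e' = phi false true by case: e'.
rewrite pe; apply: (mlin_ext (mphi _ _) (mlin_aug (ms 1))) => e' j m.
have c1 : intertwines e' e' (phi false true).
  have := congr1 (fun P : G => P true e') dphi.
  rewrite /vdiff /= phi0 (lfun0 (wordd_linear _ _ _)) subr0 /adh /pre addbF pe fappE => /eqP.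
  by rewrite subr_eq0 => /eqP.
rewrite (intertwines_h _ _ (mphi _ _) c1) shift_gap_diag slice_aug -lactA; congr lact.
elim: j => [|j IH]; first by rewrite !expr0 lact1.
have := congr1 (fun P : G => slice (gen e' ^+ j) (P false e')) dphi.
rewrite /vdiff /= phi0 (lfun0 (divd_linear _ _ _ _)) subr0 /wordd /pre addbF !pe.
rewrite expr1 scaleN1r (lfunB (slice_linear _)) slice_lact slice_ract -exprS => /eqP.
by rewrite subr_eq0 => /eqP <-; rewrite IH lactA exprS.
Qed.

(* The preimage takes the value forced by F on arguments starting with a letter that prolongs
   the word and vanishes on the others; in length 0, where every letter prolongs the word, it is
   the telescoping sum along powers of that letter. *)
Lemma wordd_exact n q F : mlinF n.+1 F -> adh q.+1 F = 0 -> wordd q.+1 F = 0 ->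
  exists X, [/\ mlinF n.+1 X, wordd q X = F, adh q X = 0 & q = 0%N -> X true = X false].
Proof.
move=> mF kF dF.
have cF e : intertwines (pre e q.+1) e (F e).
  by apply/eqP; rewrite -subr_eq0 -[_ - _]/(adh q.+1 F e) kF.
have mFs e b : mlin n (slice b (F e)) by case: (mF e) => _ _; apply.
have dFE e j : slice (gen e ^+ j.+1) (F (~~ e)) =
    (-1) ^+ q.+1 *: lact (gen (pre e q.+1)) (slice (gen e ^+ j) (F e)).
  have := congr1 (fun P : bool -> Y => slice (gen e ^+ j) (P e)) dF.
  rewrite /wordd (lfunD (slice_linear _)) (lfunZ (slice_linear _)) slice_lact slice_ract
    -exprS => /eqP.
  rewrite fappE (lfun0 (slice_linear _)) addrC addr_eq0 => /eqP.
  move=> /(congr1 (fun g => (-1) ^+ q.+2 *: g)); rewrite scalerA -expr2 sqrr_sign scale1r => ->.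
  by rewrite exprS mulN1r scaleNr scalerN opprK.
(* The last clause is [wordd q X = F] tested on powers of a letter. On powers of [gen (~~ e)] the
   product [gen e * gen (~~ e)] has become a value of a, moved to the left by intertwining, and F
   has been rewritten by [dFE]. *)
have [X [mX cX X0 Xd]] : exists X, [/\ mlinF n.+1 X, forall e, intertwines (pre e q) e (X e),
    q = 0%N -> X true = X false
  & forall e, (forall j, lact (gen (pre e q)) (slice (gen e ^+ j) (X e))
       + (-1) ^+ q.+1 *: slice (gen e ^+ j.+1) (X (~~ e)) = slice (gen e ^+ j) (F e))
   /\ (forall j, lact (gen (pre e q)) (slice (gen (~~ e) ^+ j.+1) (X e))
       + (-1) ^+ q.+1 *: lact (aval (pre e q.+1)) (slice (gen (~~ e) ^+ j) (X (~~ e)))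
     = (-1) ^+ q.+1 *: lact (gen (pre e q)) (slice (gen (~~ e) ^+ j) (F (~~ e))))].
  case: q => [|q] in kF dF cF dFE *.
    pose L e' j : Y := nat_rect (fun=> Y) 0
      (fun l X => lact (gen e') X - slice (gen e' ^+ l) (F e')) j.
    have [e' j||f [mf cf fE]] := @exists_intertwiner n true true L.
    - by elim: j => [|j IH]; [exact: mlin0 | exact: mlinB (mlin_lact _ IH) (mFs _ _)].
    - by [].
    exists (fun=> f); split=> // e; last first.
      rewrite /pre addbF; split=> j; rewrite !fE /=.
        by rewrite expr1 scaleN1r opprB addrC subrK.
      rewrite !mul_linE expr1 !scaleN1r lactA (_ : gen e * gen (~~ e) = aval (~~ e));
        last first.
        by rewrite -(gen_gen HB) negbK.
      by rewrite addbT addrAC subrr add0r.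
    apply/eqP; rewrite -subr_eq0 (adhE _ _ mf) /pre addbF shift_gap_diag -[X in lact X
      _](shift_gap_diag true).
    by rewrite -(adhE _ _ mf) cf subrr.
  pose L e e' j : Y := if (e' == ~~ e) && (j != 0%N) then
     (-1) ^+ q.+2 *: slice (gen (~~ e) ^+ j.-1) (F (~~ e)) else 0.
  have hL e : exists f, [/\ mlin n.+1 f, intertwines (pre e q.+1) e f
      & forall e' j, slice (gen e' ^+ j) f = L e e' j].
    apply: exists_intertwiner => [e' j|]; rewrite /L; last by rewrite !andbF.
    by case: ifP => _; [apply/mlinZ | apply: mlin0].
  have [f1 [mf1 cf1 f1E]] := hL true; have [f2 [mf2 cf2 f2E]] := hL false.
  exists (fun e => if e then f1 else f2); split=> // [[] //|[] //|e].
  have XE e1 e' j : slice (gen e' ^+ j) (if e1 then f1 else f2) = L e1 e' j by case: e1.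
  have s2 : (-1) ^+ q.+2 * (-1) ^+ q.+2 = 1 :> k by rewrite -expr2 sqrr_sign.
  have ne e' : (e' == ~~ e') = false by case: e'.
  have ne' e' : (~~ e' == e') = false by case: e'.
  split=> j; rewrite !XE /L /= ?negbK ?eqxx ?ne ?ne' /=.
    by rewrite (lfun0 (lact_linear _)) add0r scalerA s2 scale1r.
  by rewrite (lfun0 (lact_linear _)) scaler0 addr0 lactZr.
have dX : wordd q X = F.
  apply/funext => e; apply: (intertwines_ext (mlinF_wordd x y q mX e) (mF e) _ (cF e)).
    apply/eqP; rewrite -subr_eq0 -[_ - _]/(adh q.+1 (wordd q X) e) (wordd_adh HB).
    have -> : adh q X = 0 by apply/funext => e'; rewrite /adh cX subrr.
    by rewrite (lfun0 (wordd_linear _ _ _)).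
  have [Xd1 Xd2] := Xd e.
  move=> e' j; rewrite /wordd (lfunD (slice_linear _)) (lfunZ (slice_linear _)) slice_lact
    slice_ract.
  have [->|/eqP] := eqVneq e' e; first by rewrite -exprS Xd1.
  move=> ee'; have {e' ee'} -> : e' = ~~ e by move: (e) (e') ee' => [] [].
  case: j => [|j]; first by have := Xd1 0%N; rewrite !expr0 mulr1 expr1.
  rewrite exprS mulrA (_ : gen e * gen (~~ e) = aval (~~ e));
    last by rewrite -(gen_gen HB) negbK.
  rewrite -[slice (aval _ * _) _]slice_ract (intertwines_aval (mX _) (cX _)) slice_lact preN
    -exprS Xd2.
  by have := dFE (~~ e) j; rewrite negbK preN preS preS negbK => ->.
exists X; split=> //.
by apply/funext => e; rewrite /adh cX subrr.
Qed.

(** Surjectivity of [adh] provides X for the component [phi true]. The correction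
    [phi false - wordd q X] is killed by both [adh] and [wordd], so [wordd_exact] applies. *)
Lemma vdiff_exact n q phi : grid n.+1 q.+1 phi -> vdiff q.+1 phi = 0 ->
  exists2 psi, grid n.+1 q psi & vdiff q psi = phi.
Proof.
move=> [mphi _ phi1] dphi.
have [|X mX [kX sX]] := adh_surj (q := q) (mphi true).
  by move=> q0; apply: phi1; rewrite q0.
have d1 : adh q.+1 (phi false) = wordd q (phi true).
  by have := congr1 (fun P : G => P true) dphi => /eqP; rewrite /vdiff subr_eq0 => /eqP.
have d0 : wordd q.+1 (phi false) = divd a h0 h q (phi true).
  by have := congr1 (fun P : G => P false) dphi => /eqP; rewrite /vdiff subr_eq0 => /eqP.
have [|||Z [mZ dZ kZ sZ]] := @wordd_exact n q (phi false - wordd q X).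
- by move=> e; apply: mlinB; [exact: mphi | exact: mlinF_wordd].
- by rewrite (lfunB (adh_linear _ _ _)) (wordd_adh HB) kX d1 subrr.
- by rewrite (lfunB (wordd_linear _ _ _)) (wordd_wordd HB _ mX) kX d0 subrr.
exists (fun t => if t then 0 else X + Z); first split.
- by case=> e; [exact: mlin0 | exact: mlinD].
- by move=> q0; split=> //; rewrite !fappE sX ?sZ.
- by [].
apply/funext => -[]; rewrite /vdiff.
- by rewrite (lfunD (adh_linear _ _ _)) kX kZ (lfun0 (wordd_linear _ _ _)) subr0 addr0.
- by rewrite (lfunD (wordd_linear _ _ _)) dZ (lfun0 (divd_linear _ _ _ _)) subr0 addrC subrK.
Qed.
End Columns.

(** * The zigzag *)

(** A linear relation, total on both sides and compatible with the denominators, induces an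
    isomorphism of quotients. Relations avoid a linear choice of lifts in the zigzag. *)
Lemma qdim_rel (k : fieldType) (X1 X2 : lmodType k) (Z1 N1 : X1 -> Prop) (Z2 N2 : X2 -> Prop)
    (rho : X1 -> X2 -> Prop) m :
  rho 0 0 ->
  (forall c f f' g g', rho f g -> rho f' g' -> rho (c *: f + f') (c *: g + g')) ->
  (forall f, Z1 f -> exists2 g, Z2 g & rho f g) ->
  (forall g, Z2 g -> exists2 f, Z1 f & rho f g) ->
  (forall f g, rho f g -> N1 f <-> N2 g) ->
  qdim Z1 N1 m -> qdim Z2 N2 m.
Proof.
move=> rho0 rhoD tot1 tot2 NN [c [cZ cspan cfree]].
have /choice[d dP] : forall j, exists g, Z2 g /\ rho (c j) g.
  by move=> j; have [g gZ gr] := tot1 _ (cZ j); exists g.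
have rho_sum (coef : 'I_m -> k) :
    rho (\sum_(j < m) coef j *: c j) (\sum_(j < m) coef j *: d j).
  by apply: big_ind2 => [//|f g f' g' r r'|j _]; [rewrite -[f]scale1r -[g]scale1r|
    rewrite -[_ *: c j]addr0 -[_ *: d j]addr0]; apply: rhoD => //; case: (dP j).
exists d; split=> [j|g gZ|coef].
- by case: (dP j).
- have [f fZ fg] := tot2 g gZ; have [coef Nf] := cspan f fZ; exists coef.
  suff fgD : rho (f - \sum_(j < m) coef j *: c j) (g - \sum_(j < m) coef j *: d j).
    by apply/(NN _ _ fgD).
  by rewrite ![_ - \sum_(j < m) _]addrC -!scaleN1r; exact: rhoD.
- by move=> Nd; apply: cfree; apply/(NN _ _ (rho_sum coef)).
Qed.

Lemma qdim_iff (k : fieldType) (X : lmodType k) (Z N N' : X -> Prop) m :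
  (forall f, N f <-> N' f) -> qdim Z N m -> qdim Z N' m.
Proof.
by move=> NN; apply: (qdim_rel (rho := eq)) => // [c f f' g g' -> -> //|f fZ|f fZ|f _ <-//];
  exists f.
Qed.

Section ZigZag.
Variables (k : fieldType) (a : {poly k}) (h0 : k) (B : algType k) (h x y : B).
Hypothesis HB : is_GWA a h0 h x y.
Notation Y := (seq B -> B).
Notation G := (bool -> bool -> Y).
Notation vdiff := (vdiff a h0 h x y).
Implicit Types (phi psi v : G) (P q n m : nat).

Lemma grid_lin P q c phi psi : grid P q phi -> grid P q psi -> grid P q (c *: phi + psi).
Proof.
move=> [m1 p1 s1] [m2 p2 s2]; split=> [t e|q0|q0].
- exact: mlin_lin (m1 t e) (m2 t e).
- have [z1 w1] := p1 q0; have [z2 w2] := p2 q0.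
  by rewrite !fappE z1 z2 scaler0 addr0 w1 w2.
- by rewrite !fappE s1 ?s2.
Qed.
Lemma grid0 P q : grid P q (0 : G).
Proof. by split=> // t e; apply: mlin0. Qed.
Lemma gridB P q phi psi : grid P q phi -> grid P q psi -> grid P q (phi - psi).
Proof. by move=> K1 K2; rewrite addrC -scaleN1r; apply: grid_lin. Qed.

(* At the node (P, q) of the exact double complex, the total cocycles modulo
   hdiff (ker vdiff) = vdiff (ker hdiff); both descriptions of the denominator are needed at the
   ends of the zigzag. *)
Definition nodeZ P q phi := [/\ grid P q phi, hdiff phi = 0 & vdiff q phi = 0].
Definition nodeH P q phi := exists v, [/\ grid P.-1 q v, vdiff q v = 0 & hdiff v = phi].
Definition nodeV P q phi := exists v, [/\ grid P q.-1 v, hdiff v = 0 & vdiff q.-1 v = phi].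
Definition smallZ q phi := grid 0 q phi /\ vdiff q phi = 0.
Definition smallN q phi :=
  if q is q'.+1 then exists2 psi, grid 0 q' psi & vdiff q' psi = phi else phi = 0.

Let hdiff_lin := @hdiff_linear k B.
Let vdiff_lin := vdiff_linear a h0 h x y.

(** By injectivity and exactness of the rows, [hdiff] identifies column 0 with the kernel of [hdiff]
    in column 1. *)
Lemma small_node q m :
  qdim (smallZ q.+1) (smallN q.+1) m -> qdim (nodeZ 1 q.+1) (nodeV 1 q.+1) m.
Proof.
apply: (qdim_rel (rho := fun phi f => grid 0 q.+1 phi /\ hdiff phi = f)).
- by split; [exact: grid0 | exact: (lfun0 hdiff_lin)].
- by move=> c f f' g g' [K1 <-] [K2 <-]; split; [exact: grid_lin | exact: hdiff_lin].
- move=> phi [Kphi dphi]; exists (hdiff phi) => //; split; first exact: grid_hdiff.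
    exact: hdiff_hdiff.
  by rewrite -hdiff_vdiff dphi (lfun0 hdiff_lin).
- move=> f [Kf dhf dvf]; have [phi Kphi dphi] := hdiff_exact Kf dhf.
  exists phi => //; split=> //; apply: hdiff_inj (grid_vdiff _ _ _ _ _ Kphi) _.
  by rewrite hdiff_vdiff dphi.
- move=> phi f [Kphi <-]; split=> [[psi Kpsi <-]|[v [Kv dhv dvv]]].
    exists (hdiff psi); split; [exact: grid_hdiff | exact: hdiff_hdiff | by rewrite
      -hdiff_vdiff].
  have [c Kc cv] := hdiff_exact Kv dhv; exists c => //.
  apply/eqP; rewrite -subr_eq0; apply/eqP;
    apply: hdiff_inj (gridB (grid_vdiff _ _ _ _ _ Kc) Kphi) _.
  by rewrite (lfunB hdiff_lin) hdiff_vdiff cv dvv subrr.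
Qed.

(** The classes of [vdiff e] and [hdiff e] correspond, for e at the node between them. Changing e by
    the kernel of one differential changes the image under the other by an element of the
    denominator. *)
Lemma node_step P q m :
  qdim (nodeZ P.+1 q.+1) (nodeV P.+1 q.+1) m -> qdim (nodeZ P.+2 q) (nodeH P.+2 q) m.
Proof.
apply: (qdim_rel (rho := fun g f => exists e, [/\ grid P.+1 q e, hdiff e = f & vdiff q e = g])).
- by exists 0; rewrite (lfun0 hdiff_lin) (lfun0 (vdiff_lin _)); split=> //; exact: grid0.
- move=> c f f' g g' [e [K1 <- <-]] [e' [K2 <- <-]]; exists (c *: e + e').
  by rewrite hdiff_lin vdiff_lin; split=> //; exact: grid_lin.
- move=> g [Kg_g dhg dvg]; have [e Ke eg] := vdiff_exact HB Kg_g dvg.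
  exists (hdiff e); last by exists e.
  by split; [exact: grid_hdiff | exact: hdiff_hdiff | rewrite -hdiff_vdiff eg dhg].
- move=> f [Kf dhf dvf]; have [e Ke ef] := hdiff_exact Kf dhf.
  exists (vdiff q e); last by exists e.
  by split; [exact: grid_vdiff | rewrite hdiff_vdiff ef dvf | exact: (vdiff_vdiff HB Ke)].
- move=> g f [e [Ke <- <-]]; split=> [[v [Kv dhv dvv]]|[v [Kv dvv dhv]]];
    exists (e - v); split.
  + exact: gridB.
  + by rewrite (lfunB (vdiff_lin _)) -dvv subrr.
  + by rewrite (lfunB hdiff_lin) dhv subr0.
  + exact: gridB.
  + by rewrite (lfunB hdiff_lin) -dhv subrr.
  + by rewrite (lfunB (vdiff_lin _)) dvv subr0.
Qed.

(** Exactness of the column and of the row makes both the image of [hdiff] composed with [vdiff]. *)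
Lemma nodeHV P q phi : nodeH P.+2 q.+1 phi <-> nodeV P.+2 q.+1 phi.
Proof.
split=> [[v [Kv dvv <-]]|[v [Kv dhv <-]]].
  have [c Kc <-] := vdiff_exact HB Kv dvv; exists (hdiff c).
  by split; [exact: grid_hdiff | exact: hdiff_hdiff | rewrite -hdiff_vdiff].
have [c Kc <-] := hdiff_exact Kv dhv; exists (vdiff q c).
by split; [exact: grid_vdiff | exact: (vdiff_vdiff HB Kc) | rewrite hdiff_vdiff].
Qed.

Lemma node_chain P q m :
  qdim (nodeZ P.+1 q.+1) (nodeV P.+1 q.+1) m ->
  qdim (nodeZ (P.+2 + q) 0) (nodeH (P.+2 + q) 0) m.
Proof.
elim: q P => [|q IH] P; first by rewrite addn0; exact: node_step.
move=> /node_step /(qdim_iff (@nodeHV P q)) /IH.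
by rewrite addnS -addSn.
Qed.

Lemma ract_aug r (f : Y) : ract r (aug f) = lact r (aug f).
Proof. by apply/funext => -[|b t]; rewrite /ract /lact /aug ?mul0r ?mulr0 ?mulrA. Qed.

Definition augG (f : Y) : G := fun t _ => if t then 0 else aug f.

Lemma augG_linear : linear augG.
Proof.
move=> c f g; apply/funext => -[]; apply/funext => e; rewrite !fappE /augG.
  by rewrite scaler0 addr0.
exact: aug_linear.
Qed.
Lemma augG_inj f : augG f = 0 -> f = 0.
Proof. by move=> /(congr1 (fun P : G => P false true)); exact: aug_inj. Qed.
Lemma hdiff_augG f : hdiff (augG f) = - augG (hochd f).
Proof.
apply/funext => -[]; apply/funext => e; rewrite !fappE /hdiff /augG; last exact: bard_aug.
by rewrite (lfun0 (@bard_linear _ _)) oppr0.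
Qed.
Lemma grid_augG n f : mlin n f -> grid n.+1 0 (augG f).
Proof. by move=> mf; split=> // -[] e; [exact: mlin0 | exact: mlin_aug]. Qed.
Lemma vdiff_augG f : vdiff 0 (augG f) = 0.
Proof.
apply/funext => -[]; rewrite /vdiff /augG /=.
  rewrite -[fun _ => 0]/(0 : bool -> Y) (lfun0 (wordd_linear _ _ _)) subr0.
  by apply/funext => e; rewrite /adh /pre addbF ract_aug subrr.
rewrite -[fun _ => 0]/(0 : bool -> Y) (lfun0 (divd_linear _ _ _ _)) subr0.
by apply/funext => e; rewrite /wordd /pre addbF ract_aug expr1 scaleN1r subrr.
Qed.

(** In the bottom row the kernel of [vdiff] consists of the [augG f], and there [hdiff] is minus the
    Hochschild differential. *)
Lemma node_bar n m :
  qdim (nodeZ n.+2 0) (nodeH n.+2 0) m -> qdim (@barZ k B n.+1) (@barN k B n.+1) m.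
Proof.
apply: (qdim_rel (rho := fun phi f => mlin n.+1 f /\ phi = augG f)).
- by split; [exact: mlin0 | rewrite (lfun0 augG_linear)].
- by move=> c f f' g g' [K1 ->] [K2 ->]; split; [exact: mlin_lin | rewrite augG_linear].
- move=> phi [Kphi dhphi dvphi]; have [f mf phiE] := vdiff_exact0 HB Kphi dvphi.
  exists f => //; split=> //; apply: augG_inj; apply/eqP; rewrite -oppr_eq0; apply/eqP.
  by rewrite -hdiff_augG -[RHS]dhphi phiE.
- move=> f [mf df]; exists (augG f) => //; split; first exact: grid_augG.
    by rewrite hdiff_augG df (lfun0 augG_linear) oppr0.
  exact: vdiff_augG.
- move=> phi f [mf ->]; split=> [[v [Kv dvv dhv]]|[g mg ->]].
    have [g mg vE] := vdiff_exact0 HB Kv dvv; exists (- g); first exact: mlinN.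
    apply/eqP; rewrite -subr_eq0; apply/eqP; apply: augG_inj.
    rewrite (lfunN (@hochd_linear _ _)) opprK (lfunD augG_linear) -dhv vE.
    by rewrite -[hdiff _]/(hdiff (augG g)) hdiff_augG addNr.
  exists (augG (- g)); split; first exact/grid_augG/mlinN.
    exact: vdiff_augG.
  by rewrite hdiff_augG (lfunN (@hochd_linear _ _)) (lfunN augG_linear) opprK.
Qed.

Lemma HH_dim_of_small n m :
  qdim (smallZ n.+1) (smallN n.+1) m -> HH_dim B n.+1 m.
Proof.
move=> /small_node /node_chain; rewrite addSn add1n => /node_bar.
exact: HH_dim_of_bar.
Qed.

End ZigZag.

(** * Weight-zero cochains *)

Section WeightKernel.
Variables (k : fieldType) (Hchar : [pchar k] =i pred0).
Variables (a : {poly k}) (h0 : k) (Hh0 : h0 != 0) (B : algType k) (h x y : B).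
Hypothesis HB : is_GWA a h0 h x y.
Notation Y := (seq B -> B).
Notation G := (bool -> bool -> Y).
Notation gen := (gen x y).
Notation hshift := (hshift h0 h).
Notation wordd := (wordd x y).
Notation adh := (adh h0 h).
Notation divd := (divd a h0 h).
Implicit Types (e t i : bool) (q n : nat) (F : bool -> Y) (f g : Y) (p r : {poly k}).

Lemma natr_eq0_char0 n : (n%:R == 0 :> k) = (n == 0%N).
Proof. by have /pcharf0P -> := Hchar. Qed.

Lemma peval_shift p e : peval (p \Po ('X + (if e then 0 else h0)%:P)) (hshift e) = peval p h
  :> B.
Proof.
by rewrite peval_comp !peval_horner rmorphD /= horner_algX horner_algC /hshift subrK.
Qed.

Definition adB i e (b : B) := hshift i * b - b * hshift e.
Lemma adB_linear i e : linear (adB i e).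
Proof.
by move=> c u v; rewrite /adB mulrDr [(_ + v) * _]mulrDl -scalerAr -scalerAl scalerBr opprD
  addrACA.
Qed.

Definition shift_const e : k := if e then 0 else h0.
Definition weight_const e : k := if e then h0 else - h0.

Lemma gen_expr_h e j : gen e ^+ j * h = (h - (weight_const e *+ j)%:A) * gen e ^+ j.
Proof.
elim: j => [|j IH]; first by rewrite expr0 mul1r mulr1 mulr0n scale0r subr0.
have lh : gen e * h = (h - (weight_const e)%:A) * gen e.
  have := gen_peval_h HB e 'X; rewrite comp_polyX pevalX => ->.
  by rewrite peval_horner rmorphB /= horner_algX horner_algC.
rewrite exprS -mulrA IH mulrA mulrBr lh mulr_algr -[_ *: gen e]mulr_algl -mulrBl -mulrA;
  congr (_ * _).
by rewrite mulrS scalerDl opprD addrA.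
Qed.

Definition eigval i e e' j : k := weight_const e' *+ j + shift_const e - shift_const i.

Lemma adB_basis i e e' j m :
  adB i e (h ^+ m * gen e' ^+ j) = eigval i e e' j *: (h ^+ m * gen e' ^+ j).
Proof.
rewrite /adB /hshift mulrBr mulrBl -[_ * _ * h]mulrA gen_expr_h.
rewrite [h ^+ m * ((h - _) * _)]mulrA mulrBr mulrBl mulr_algr mulr_algl mulr_algr.
rewrite -scalerAl mulrA -exprS -exprSr /eigval scalerBl scalerDl -/(shift_const e)
  -/(shift_const i).
set z := h ^+ m * _; set w := h ^+ m.+1 * _.
by rewrite -[w - _ - shift_const e *: z]addrA -opprD opprB addrC addrA subrK.
Qed.

Lemma mulrn_h0_eq0 n : (h0 *+ n == 0) = (n == 0%N).
Proof. by rewrite -mulr_natr mulf_eq0 (negbTE Hh0) natr_eq0_char0. Qed.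

(** Eigenvalues are integer multiples of h0, so in characteristic zero only the integer matters: the
    monomial must have weight 0 for even q, and the weight of [gen e] for odd q. *)
Lemma eigval_eq0 e q e' j :
  (eigval (pre e q) e e' j == 0) = if odd q then (e' == e) && (j == 1%N) else j == 0%N.
Proof.
rewrite /eigval /pre /weight_const /shift_const; case: (odd q); last first.
  by rewrite addbF addrK; case: e'; rewrite ?mulNrn ?oppr_eq0 mulrn_h0_eq0.
rewrite addbT; case: e e' => -[] /=; rewrite ?addr0 ?subr0.
- case: j => [|j]; first by rewrite mulr0n sub0r oppr_eq0 (negbTE Hh0).
  by rewrite mulrS addrAC subrr add0r mulrn_h0_eq0.
- by rewrite mulNrn -opprD oppr_eq0 -mulrSr mulrn_h0_eq0.
- by rewrite -mulrSr mulrn_h0_eq0.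
- case: j => [|j]; first by rewrite mulr0n add0r (negbTE Hh0).
  by rewrite mulrS addrAC addNr add0r mulNrn oppr_eq0 mulrn_h0_eq0.
Qed.

(** Weight-zero elements, with the polynomial evaluated at [hshift e] instead of h; this keeps all
    shifts out of [polyd]. *)
Definition welt q p e : B := (if odd q then gen e else 1) * peval p (hshift e).

Lemma adB_welt q p e : adB (pre e q) e (welt q p e) = 0.
Proof.
have hp : hshift e * peval p (hshift e) = peval p (hshift e) * hshift e by apply: comm_peval.
rewrite /adB /welt /pre; case: (odd q); rewrite ?addbT ?addbF ?mul1r; last by rewrite hp subrr.
by rewrite mulrA -(gen_hshift HB) -!mulrA hp subrr.
Qed.

Lemma welt_linear q e : linear (welt q ^~ e).
Proof. by move=> c p r; rewrite /welt peval_lin mulrDr -scalerAr. Qed.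

Lemma welt_span q e b : exists p c, b = welt q p e + adB (pre e q) e c.
Proof.
elim: (gspan_all HB b) => [|c e' j m v _ [p [b' ->]]].
  exists 0, 0; rewrite (lfun0 (adB_linear _ _)) addr0.
  by rewrite (lfun0 (welt_linear q e)).
have [r [d ->]] : exists r d, h ^+ m * gen e' ^+ j = welt q r e + adB (pre e q) e d.
  have [e0|ne0] := eqVneq (eigval (pre e q) e e' j) 0; last first.
    (* An eigenvector with nonzero eigenvalue is the image of its multiple by the inverse. *)
    exists 0, ((eigval (pre e q) e e' j)^-1 *: (h ^+ m * gen e' ^+ j)).
    rewrite (lfun0 (welt_linear q e)) add0r (lfunZ (adB_linear _ _)) adB_basis scalerA.
    by rewrite mulVf // scale1r.
  move/eqP: e0; rewrite eigval_eq0 /welt; case: (odd q) => [/andP[/eqP-> /eqP->]|/eqP->].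
    exists ('X^m \Po ('X + (shift_const (~~ e))%:P)), 0; rewrite (lfun0 (adB_linear _ _)) addr0.
    by rewrite expr1 (gen_peval HB) peval_shift pevalXn.
  exists ('X^m \Po ('X + (shift_const e)%:P)), 0; rewrite (lfun0 (adB_linear _ _)) addr0 mul1r.
  by rewrite peval_shift pevalXn expr0 mulr1.
exists (c *: r + p), (c *: d + b'); rewrite (welt_linear q e) (adB_linear _ _).
by rewrite scalerDr addrACA.
Qed.

(* ad h is diagonalizable, so its square has the same kernel. *)
Lemma adB_adB i e b : adB i e (adB i e b) = 0 -> adB i e b = 0.
Proof.
have [|R [lR RE]] := @exists_linear_ext _ _ _ _ _ _ _ HB B
  (fun e' j m => (eigval i e e' j)^-1 *: (h ^+ m * gen e' ^+ j)).
  by move=> m; rewrite /eigval !mulr0n !expr0.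
move=> e0; suff -> : adB i e b = R (adB i e (adB i e b)) by rewrite e0 (lfun0 lR).
apply: (linear_ext HB (F := adB i e) (G := fun b => R (adB i e (adB i e b)))).
- exact: adB_linear.
- by move=> c u v; rewrite !adB_linear lR.
move=> e' j m; rewrite adB_basis !(lfunZ (adB_linear _ _)) adB_basis !(lfunZ lR) RE !scalerA.
have [->|ne0] := eqVneq (eigval i e e' j) 0; first by rewrite !mul0r.
by rewrite mulfK.
Qed.

Lemma adB_ker q e b : adB (pre e q) e b = 0 -> exists p, b = welt q p e.
Proof.
have [p [c ->]] := welt_span q e b.
rewrite (lfunD (adB_linear _ _)) adB_welt add0r => /adB_adB ->.
by exists p; rewrite addr0.
Qed.

Lemma welt_inj q p e : welt q p e = 0 -> p = 0.
Proof.
have [cf [lcf cfE]] := exists_coord HB.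
have inj e' r : peval r (hshift e') = peval (sh (shift_const e') r) h.
  by rewrite /sh peval_comp peval_hshift.
have sh0 e' r : sh (shift_const e') r = 0 -> r = 0.
  by move=> r0; rewrite -(shK (shift_const e') r) r0 /shi comp_poly0.
rewrite /welt; case: (odd q).
  rewrite (gen_peval HB) inj -[gen e]expr1 => /(congr1 (cf e 1%N)).
  by rewrite cfE !eqxx (lfun0 (lcf _ _)) => /sh0.
rewrite mul1r inj -[peval _ h]mulr1 -(expr0 (gen e)) => /(congr1 (cf e 0%N)).
by rewrite cfE !eqxx (lfun0 (lcf _ _)) => /sh0.
Qed.

Definition cst0 (b : B) : Y := fun s => if s is [::] then b else 0.
Definition wcochain q (P : bool -> {poly k}) : bool -> Y := fun e => cst0 (welt q (P e) e).

Lemma cst_linear : linear cst0.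
Proof. by move=> c u v; apply/funext => -[|b s]; rewrite !fappE //= scaler0 addr0. Qed.
Lemma mlin_cst b : mlin 0 (cst0 b). Proof. by []. Qed.
Lemma cst0E f : mlin 0 f -> f = cst0 (f [::]).
Proof. by move=> mf; apply/funext => -[|b s] //=; rewrite mf. Qed.
Lemma cst_inj b : cst0 b = 0 -> b = 0.
Proof. by move=> /(congr1 (fun f : Y => f [::])). Qed.
Lemma lact_cst (c b : B) : lact c (cst0 b) = cst0 (c * b).
Proof. by apply/funext => -[|d s]; rewrite /lact //= mulr0. Qed.
Lemma ract_cst (c b : B) : ract c (cst0 b) = cst0 (b * c).
Proof. by apply/funext => -[|d s]. Qed.

Lemma adh_cst q (P : bool -> B) :
  adh q (fun e => cst0 (P e)) = fun e => cst0 (adB (pre e q) e (P e)).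
Proof. by apply/funext => e; rewrite /adh lact_cst ract_cst -(lfunB cst_linear). Qed.

Lemma mlinF_cst F : mlinF 0 F -> F = fun e => cst0 (F e [::]).
Proof. by move=> mF; apply/funext => e; apply: cst0E. Qed.

Lemma adh_wcochain q P : adh q (wcochain q P) = 0.
Proof. by rewrite /wcochain adh_cst; apply/funext => e;
  rewrite adB_welt (lfun0 cst_linear). Qed.

Lemma mlinF_wcochain q P : mlinF 0 (wcochain q P). Proof. by []. Qed.

Lemma wcochain_linear q : linear (wcochain q).
Proof.
by move=> c P R; apply/funext => e; rewrite /wcochain !fappE (welt_linear q e) cst_linear.
Qed.

Lemma wcochain_inj q P : wcochain q P = 0 -> P = 0.
Proof.
move=> W0; apply/funext => e; apply: (@welt_inj q _ e); apply: cst_inj.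
by rewrite -[LHS]/(wcochain q P e) W0.
Qed.

Lemma adh_ker q F : mlinF 0 F -> adh q F = 0 -> exists P, F = wcochain q P.
Proof.
move=> mF; rewrite (mlinF_cst mF) adh_cst => k0.
have /choice[P PE] : forall e, exists p, F e [::] = welt q p e.
  move=> e; apply: adB_ker; apply: cst_inj.
  by have := congr1 (fun X : bool -> Y => X e) k0.
by exists P; apply/funext => e; rewrite PE.
Qed.

Lemma adh_adh q F : mlinF 0 F -> adh q (adh q F) = 0 -> adh q F = 0.
Proof.
move=> mF; rewrite (mlinF_cst mF) !adh_cst => k0; apply/funext => e.
rewrite adB_adB ?(lfun0 cst_linear) //; apply: cst_inj.
by have := congr1 (fun X : bool -> Y => X e) k0.
Qed.

Lemma adh_span q F : mlinF 0 F -> (q = 0%N -> F true = F false) ->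
  exists P X, [/\ F = wcochain q P + adh q X, mlinF 0 X, q = 0%N -> X true = X false &
    q = 0%N -> wcochain 0 P true = wcochain 0 P false].
Proof.
move=> mF; rewrite (mlinF_cst mF).
have /choice[P /choice[X PX]] : forall e, exists p c, F e [::] = welt q p e + adB (pre e q) e c.
  by move=> e; exact: welt_span.
case: q PX => [|q] PX sF.
  (* On the empty word both components must be the same element of B; [s e] rewrites the polynomial
     [P true] in the variable [hshift e]. *)
  pose s (e : bool) := P true \Po ('X - (shift_const true)%:P) \Po ('X + (shift_const e)%:P).
  exists s, (fun _ => cst0 (X true)).
  have sE e : welt 0 (s e) e = welt 0 (P true) true.
    rewrite /welt !mul1r /s peval_shift peval_comp.
    by rewrite (peval_hshift h0 h true).
  split=> // [|_]; last by rewrite /wcochain !sE.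
  rewrite adh_cst; apply/funext => e; rewrite fappE /wcochain sE -(lfunD cst_linear).
  have -> : cst0 (F e [::]) = cst0 (F true [::]) by case: e => //; rewrite sF.
  rewrite PX; congr (cst0 (_ + _));
    rewrite /adB /pre !addbF /hshift !mulrBl !mulrBr !mulr_algl !mulr_algr.
  by rewrite !opprB !addrA !subrK.
exists P, (fun e => cst0 (X e)); split=> //.
by rewrite adh_cst; apply/funext => e; rewrite fappE /wcochain -(lfunD cst_linear) PX.
Qed.

Definition polyd q (P : bool -> {poly k}) : bool -> {poly k} :=
  fun e => if odd q then a * (P e + P (~~ e)) else P e - P (~~ e).

Lemma wordd_wcochain q P : wordd q (wcochain q P) = wcochain q.+1 (polyd q P).
Proof.
apply/funext => e; rewrite /wordd /wcochain lact_cst ract_cst -(lfunZ cst_linear) -(lfunD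
  cst_linear).
congr cst0; rewrite /welt /polyd /pre /= -signr_odd /=; case: (odd q); rewrite /= ?addbT ?addbF.
  rewrite expr0 scale1r mul1r -[gen (~~ e) * _ * _]mulrA -(gen_peval HB) !mulrA (gen_gen HB)
    -mulrDr.
  by rewrite peval_mul -(lfunD (peval_lin _)).
rewrite !mul1r expr1 scaleN1r -(gen_peval HB) -mulrBr.
by rewrite (lfunB (peval_lin _)).
Qed.

Lemma deriv_sum p : p^`() = \sum_(i < size p) p`_i *: \sum_(m < i) 'X^(i - m.+1) * 'X^m.
Proof.
rewrite -{1}[p]coefK poly_def raddf_sum; apply: eq_bigr => i _ /=.
rewrite derivZ derivXn; congr (_ *: _).
rewrite (eq_bigr (fun _ => 'X^(i.-1))) => [|m _]; first by rewrite sumr_const card_ord.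
by rewrite -exprD; congr ('X ^+ _);
  rewrite subnS addnC -subn1 addnBA ?subn_gt0 ?subnKC ?subn1 // ltnW.
Qed.

(** For even q both actions are by the same [hshift e], which commutes with the value; on this
    diagonal the divided difference of a is its derivative, by [deriv_sum]. *)
Lemma divd_wcochain q P : ~~ odd q -> divd q (wcochain q P) = wcochain q.+2 (fun e => a^`() *
  P e).
Proof.
move=> oq; apply/funext => e; rewrite /wcochain /divd /pre (negbTE oq) addbF.
rewrite /welt /= negbK (negbTE oq) !mul1r peval_mul deriv_sum.
have hp : hshift e * peval (P e) (hshift e) = peval (P e) (hshift e) * hshift e by apply:
  comm_peval.
move: (peval (P e) _) hp => b hp.
rewrite (lfun_sum (peval_lin _)) big_distrl (lfun_sum cst_linear); apply: eq_bigr => i _ /=.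
rewrite (lfunZ (peval_lin _)) -scalerAl (lfunZ cst_linear); congr (_ *: _).
rewrite (lfun_sum (peval_lin _)) big_distrl (lfun_sum cst_linear); apply: eq_bigr => m _ /=.
rewrite ract_cst lact_cst peval_mul !pevalXn -mulrA; congr (cst0 (_ * _)).
by elim: (nat_of_ord m) => [|l IH]; rewrite ?expr0 ?mulr1 ?mul1r // exprS -mulrA -IH !mulrA hp.
Qed.

End WeightKernel.

(** * The difference operator in characteristic zero *)

Section Difference.
Variables (k : fieldType) (Hchar : [pchar k] =i pred0) (h0 : k) (Hh0 : h0 != 0).
Implicit Types (p q r s : {poly k}).

Lemma size_deriv_char0 p : size p^`() = (size p).-1.
Proof.
case sp: (size p) => [|n]; first by move/eqP: sp; rewrite size_poly_eq0 => /eqP ->;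
  rewrite deriv0 size_poly0.
have p0 : p != 0 by rewrite -size_poly_gt0 sp.
apply/eqP; rewrite eqn_leq; apply/andP; split; first by rewrite -ltnS -sp lt_size_deriv.
case: n sp => // n sp; rewrite ltnNge; apply/negP => /(nth_default 0)/eqP.
rewrite coef_deriv -mulr_natr mulf_eq0 (natr_eq0_char0 Hchar) orbF -[n.+1]/(n.+2.-1) -sp.
by rewrite -lead_coefE lead_coef_eq0 (negbTE p0).
Qed.

Lemma sh_linear : linear (sh h0).
Proof. by move=> c p q; rewrite /sh comp_polyD comp_polyZ. Qed.

Lemma sh_Xn n : exists2 r : {poly k},
  (size r <= n)%N & sh h0 'X^(n.+1) = 'X^(n.+1) - (h0 *+ n.+1) *: 'X^n + r.
Proof.
rewrite /sh; elim: n => [|n [r rn IH]].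
  by exists 0; rewrite ?size_poly0 // !expr1 comp_polyX expr0 mulr1n alg_polyC addr0.
exists (h0 *: ((h0 *+ n.+1) *: 'X^n - r) + 'X * r).
  apply: leq_trans (size_polyD _ _) _; rewrite geq_max; apply/andP; split.
    apply: leq_trans (size_scale_leq _ _) _; apply: leq_trans (size_polyD _ _) _.
    rewrite geq_max size_polyN (leq_trans rn) // andbT.
    by apply: leq_trans (size_scale_leq _ _) _; rewrite size_polyXn.
  by apply: leq_trans (size_polyMleq _ _) _; rewrite size_polyX.
rewrite exprS comp_polyM comp_polyX IH -!mul_polyC !exprS !mulrS !polyCD; ring.
Qed.

Lemma sh_diff_size n p : (size p <= n.+1)%N -> (size (sh h0 p - p)%R <= n)%N.
Proof.
move=> pn; have -> : p = \sum_(i < n.+1) p`_i *: 'X^i.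
  rewrite -[LHS]coefK poly_def (big_ord_widen _ (fun i => p`_i *: 'X^i) pn) big_mkcond /=.
  by apply: eq_bigr => i _; case: ltnP => // /(nth_default 0) ->; rewrite scale0r.
rewrite (lfun_sum sh_linear) -sumrB; apply: leq_trans (size_sum _ _ _) _.
apply/bigmax_leqP => -[[|i] /= i_n] _; rewrite (lfunZ sh_linear) -scalerBr.
  by rewrite expr0 /sh comp_polyC subrr scaler0 size_poly0.
apply: leq_trans (size_scale_leq _ _) _; have [r rn ->] := sh_Xn i.
rewrite addrAC [_ - _ - _]addrAC subrr sub0r.
apply: leq_trans (size_polyD _ _) _; rewrite geq_max size_polyN (leq_trans rn (ltnW i_n)) andbT.
by apply: leq_trans (size_scale_leq _ _) _; rewrite size_polyXn.
Qed.

Lemma sh_diff_coef n p : (size p <= n.+2)%N -> (sh h0 p - p)`_n = - (h0 *+ n.+1) * p`_n.+1.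
Proof.
move=> pn; have {1 2}-> : p = \poly_(i < n.+1) p`_i + p`_n.+1 *: 'X^(n.+1).
  apply/polyP => i; rewrite coefD coef_poly coefZ coefXn.
  case: ltngtP => [i_n|i_n|->]; rewrite ?mulr0 ?addr0 ?add0r ?mulr1 //.
  by rewrite nth_default // (leq_trans pn).
rewrite (lfunD sh_linear) opprD addrACA coefD (lfunZ sh_linear) -scalerBr coefZ.
have p1n := size_poly n.+1 (fun i => p`_i).
rewrite nth_default ?sh_diff_size // add0r.
have [r rn ->] := sh_Xn n; rewrite addrAC [_ - _ - _]addrAC subrr sub0r.
by rewrite coefD coefN coefZ coefXn eqxx mulr1 (nth_default _ rn) addr0 mulrC.
Qed.

Lemma mulrn_h0_neq0 n : h0 *+ n.+1 != 0.
Proof. by rewrite (mulrn_h0_eq0 Hchar Hh0). Qed.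

(** In characteristic zero [sh h0 p - p] has degree exactly one less than a non-constant p. *)
Lemma sh_fix p : sh h0 p = p -> (size p <= 1)%N.
Proof.
move=> pE; case sp: (size p) => [//|[//|n]]; exfalso.
have := @sh_diff_coef n p; rewrite sp leqnn pE subrr coef0 => /(_ isT)/esym/eqP.
rewrite mulf_eq0 oppr_eq0 (negbTE (mulrn_h0_neq0 n)) /= -[n.+1]/(n.+2.-1) -sp.
by rewrite -lead_coefE lead_coef_eq0 -size_poly_eq0 sp.
Qed.

Lemma sh_diff_surj r : exists s, sh h0 s - s = r.
Proof.
have [n rn] : exists n, (size r <= n)%N by exists (size r).
elim: n r rn => [|n IH] r rn.
  exists 0; rewrite /sh comp_poly0 subr0; apply/esym/eqP.
  by rewrite -size_poly_eq0 -leqn0.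
(* By [sh_diff_coef] the difference of this monomial has the same coefficient of degree n as r, so
   subtracting it lowers the size bound. *)
pose X := (- (r`_n / (h0 *+ n.+1))) *: 'X^(n.+1).
have Xn : (size X <= n.+2)%N.
  by apply: leq_trans (size_scale_leq _ _) _; rewrite size_polyXn.
have [|s sE] := IH (r - (sh h0 X - X)).
  apply/leq_sizeP => j; rewrite leq_eqVlt coefB => /orP[/eqP<-|nj].
    rewrite sh_diff_coef // coefZ coefXn eqxx mulr1 mulrNN mulrC divfK ?subrr //.
    exact: mulrn_h0_neq0.
  by rewrite !nth_default ?subr0 //; apply: leq_trans nj; [exact: sh_diff_size|exact: rn].
exists (s + X).
by rewrite (lfunD sh_linear) opprD addrACA sE subrK.
Qed.
End Difference.

(** * Cohomology of the small complex *)

Section SmallCohomology.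
Variables (k : fieldType) (Hchar : [pchar k] =i pred0).
Variables (a : {poly k}) (Ha : (1 < size a)%N) (h0 : k) (Hh0 : h0 != 0) (B : algType k) (h x y
  : B).
Hypothesis HB : is_GWA a h0 h x y.
Notation Y := (seq B -> B).
Notation G := (bool -> bool -> Y).
Notation wordd := (wordd x y).
Notation adh := (adh h0 h).
Notation divd := (divd a h0 h).
Notation vdiff := (vdiff a h0 h x y).
Notation wcochain := (wcochain h0 h x y).
Notation polyd := (polyd a).
Notation smallZ := (smallZ a h0 h x y).
Notation smallN := (smallN a h0 h x y).
Implicit Types (e t : bool) (q n : nat) (P R : bool -> {poly k}) (p r u v : {poly k}).

Let wordd_lin := wordd_linear x y.
Let adh_lin := adh_linear h0 h.
Let divd_lin := divd_linear a h0 h.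

Definition shift_sym P := P true = sh h0 (P false).

Lemma wcochain_shift_sym P : wcochain 0 P true = wcochain 0 P false <-> shift_sym P.
Proof.
rewrite /shift_sym.
have W e : wcochain 0 P e = cst0 (welt h0 h x y 0 (if e then P true else sh h0 (P false)) true).
  by case: e; rewrite /wcochain /welt ?mul1r /= hshift_true /sh // peval_comp (peval_hshift h0
    h false).
rewrite !W; split=> [e|-> //]; apply/eqP; rewrite -subr_eq0; apply/eqP.
apply: (welt_inj HB (q := 0) (e := true)); apply: cst_inj.
by rewrite (lfunB (welt_linear h0 h x y 0 true)) (lfunB (@cst_linear k B)) e subrr.
Qed.

Definition wpair q P R : G := fun t => if t then wcochain q R else wcochain q.+1 P.

(** Every cocycle has weight zero modulo a boundary: the part of [phi true] of nonzero weight is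
    [adh q X], and X is absorbed in [psi]. *)
Lemma cocycle_red q phi : smallZ q.+1 phi -> exists P R psi,
  [/\ grid 0 q psi /\ phi = vdiff q psi + wpair q P R, polyd q R = 0,
      wcochain q.+2 (polyd q.+1 P) = divd q (wcochain q R) & q = 0%N -> shift_sym R].
Proof.
move=> [[mphi _ phi1] dphi].
have [|R [X [RX mX sX sR]]] := adh_span Hchar Hh0 HB (q := q) (mphi true).
  by move=> q0; apply: phi1; rewrite q0.
have d1 : adh q.+1 (phi false) = wordd q (phi true).
  by have := congr1 (fun P : G => P true) dphi => /eqP; rewrite /vdiff subr_eq0 => /eqP.
have d0 : wordd q.+1 (phi false) = divd q (phi true).
  by have := congr1 (fun P : G => P false) dphi => /eqP; rewrite /vdiff subr_eq0 => /eqP.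
pose F := phi false - wordd q X.
have mF : mlinF 0 F by move=> e; apply: mlinB; [exact: mphi | exact: mlinF_wordd].
have kF : adh q.+1 F = wcochain q.+1 (polyd q R).
  rewrite (lfunB (adh_lin _)) (wordd_adh HB) d1 -(lfunB (wordd_lin _)) RX addrK.
  exact: (wordd_wcochain HB).
(* [adh F] lies both in the image and in the kernel of a diagonalizable map. *)
have kF0 : adh q.+1 F = 0 by apply: (adh_adh HB) => //; rewrite kF (adh_wcochain HB).
have [P FP] := adh_ker Hchar Hh0 HB mF kF0.
exists P, R, (fun t => if t then 0 else X); split.
- split; first by split=> [[] e|q0|//]; [exact: mlin0 | exact: mX | split=> //; exact: sX].
  apply/funext => -[]; rewrite addappE /vdiff /wpair /= ?(lfun0 (wordd_lin _)) ?(lfun0 (divd_lin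
    _)) subr0.
    by rewrite RX addrC.
  by rewrite -FP addrC subrK.
- by apply: (wcochain_inj HB (q := q.+1)); rewrite -kF.
- rewrite -(wordd_wcochain HB) -FP (lfunB (wordd_lin _)) (wordd_wordd HB _ mX) d0 -(lfunB (divd_lin
  _)).
  by rewrite RX addrK.
- by move=> q0; apply/wcochain_shift_sym/sR.
Qed.

(** A boundary of weight zero is the boundary of a cochain of weight zero; the splitting is now
    applied to the preimage. *)
Lemma boundary_red q P R : smallN q.+1 (wpair q P R) ->
  if q is q'.+1 then exists P' R', [/\ R = - polyd q' R',
     wcochain q.+1 P = wcochain q.+1 (polyd q P') - divd q' (wcochain q' R') & q' = 0%N ->
       shift_sym R']
  else R = 0 /\ exists P', shift_sym P' /\ P = polyd 0 P'.
Proof.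
move=> [psi [mpsi psi0 psi1] dpsi].
have d1 : adh q (psi false) = wcochain q R + wordd q.-1 (psi true).
  by have := congr1 (fun P : G => P true) dpsi => /eqP; rewrite /vdiff subr_eq => /eqP.
have d0 : wordd q (psi false) = wcochain q.+1 P + divd q.-1 (psi true).
  by have := congr1 (fun P : G => P false) dpsi => /eqP; rewrite /vdiff subr_eq => /eqP.
case: q => [|q] in P R dpsi psi0 psi1 d1 d0 *.
  have [p0 ps] := psi0 erefl; move: d1 d0;
    rewrite p0 (lfun0 (wordd_lin _)) (lfun0 (divd_lin _)) !addr0.
  move=> d1 d0; have k0 : adh 0 (psi false) = 0.
    by apply: (adh_adh HB) => //; rewrite d1 (adh_wcochain HB).
  have [P' P'E] := adh_ker Hchar Hh0 HB (mpsi false) k0.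
  split; first by apply: (wcochain_inj HB (q := 0)); rewrite -d1.
  exists P'; split; first by apply/wcochain_shift_sym; rewrite -P'E.
  apply/eqP; rewrite -subr_eq0; apply/eqP; apply: (wcochain_inj HB (q := 1)).
  by rewrite (lfunB (wcochain_linear _ _ _ _ _)) -d0 P'E (wordd_wcochain HB) subrr.
have [|R' [X [RX mX sX sR]]] := adh_span Hchar Hh0 HB (q := q) (mpsi true).
  by move=> q0; apply: psi1; rewrite q0.
pose F := psi false - wordd q X.
have mF : mlinF 0 F by move=> e; apply: mlinB; [exact: mpsi | exact: mlinF_wordd].
have kF : adh q.+1 F = wcochain q.+1 (R + polyd q R').
  rewrite (lfunB (adh_lin _)) (wordd_adh HB) d1 -addrA -(lfunB (wordd_lin _)) RX addrK.
  by rewrite (wordd_wcochain HB) (lfunD (wcochain_linear _ _ _ _ _)).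
have kF0 : adh q.+1 F = 0 by apply: (adh_adh HB) => //; rewrite kF (adh_wcochain HB).
have [P' FP] := adh_ker Hchar Hh0 HB mF kF0.
exists P', R'; split.
- by apply/eqP; rewrite -subr_eq0 opprK; apply/eqP; apply: (wcochain_inj HB (q := q.+1));
  rewrite -kF.
- rewrite -(wordd_wcochain HB) -FP (lfunB (wordd_lin _)) (wordd_wordd HB _ mX) d0 /=.
  rewrite -addrA -opprD -(lfunD (divd_lin _)) [adh q X + _]addrC -RX.
  by rewrite addrK.
- by move=> q0; apply/wcochain_shift_sym/sR.
Qed.

(** The pair (sigma(s), s) is admissible even for q = 0. On such pairs [polyd] is the difference
    operator, which is onto. *)
Lemma polyd_even_exact q R : ~~ odd q -> R true + R false = 0 ->
  exists R0, polyd q R0 = R /\ (q = 0%N -> shift_sym R0).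
Proof.
move=> /negbTE oq; move/eqP; rewrite addr_eq0 => /eqP Rt.
have [s sE] := sh_diff_surj Hchar Hh0 (R true).
exists (fun e => if e then sh h0 s else s); split=> //; apply/funext => -[];
  rewrite /polyd oq //.
by rewrite -opprB sE Rt opprK.
Qed.

End SmallCohomology.

Lemma qdim_map (k : fieldType) (X1 X2 : lmodType k) (Z1 N1 : X1 -> Prop) (Z2 N2 : X2 -> Prop)
    (E : X1 -> X2) m :
  linear E -> (forall f g, N2 f -> N2 g -> N2 (f + g)) ->
  (forall p, Z1 p -> Z2 (E p)) ->
  (forall f, Z2 f -> exists2 p, Z1 p & N2 (f - E p)) ->
  (forall p, N1 p <-> N2 (E p)) ->
  qdim Z1 N1 m -> qdim Z2 N2 m.
Proof.
move=> lE N2D ZE sE NE [c [cZ cspan cfree]].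
have Esum (coef : 'I_m -> k) : \sum_(j < m) coef j *: E (c j) = E (\sum_(j < m) coef j *: c j).
  by rewrite (lfun_sum lE); apply: eq_bigr => j _; rewrite (lfunZ lE).
exists (E \o c); split=> [j|f fZ|coef]; first exact: ZE.
  have [p pZ Nfp] := sE f fZ; have [coef Np] := cspan p pZ; exists coef.
  rewrite Esum -[f](subrK (E p)) -addrA -(lfunB lE).
  by apply: N2D => //; apply/NE.
by rewrite Esum => /NE; apply: cfree.
Qed.

Lemma qdim0 (k : fieldType) (X : lmodType k) (Z N : X -> Prop) :
  (forall f, Z f -> N f) -> qdim Z N 0.
Proof.
move=> ZN; exists (fun=> 0); split=> [[] //|f fZ|coef _ []//].
by exists (fun=> 0); rewrite big_ord0 subr0; apply: ZN.
Qed.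

Section SmallCohomology2.
Variables (k : fieldType) (Hchar : [pchar k] =i pred0).
Variables (a : {poly k}) (Ha : (1 < size a)%N) (h0 : k) (Hh0 : h0 != 0) (B : algType k) (h x y
  : B).
Hypothesis HB : is_GWA a h0 h x y.
Notation Y := (seq B -> B).
Notation G := (bool -> bool -> Y).
Notation adh := (adh h0 h).
Notation divd := (divd a h0 h).
Notation vdiff := (vdiff a h0 h x y).
Notation wcochain := (wcochain h0 h x y).
Notation wpair := (wpair h0 h x y).
Notation polyd := (polyd a).
Notation smallZ := (smallZ a h0 h x y).
Notation smallN := (smallN a h0 h x y).
Notation shift_sym := (shift_sym h0).
Implicit Types (e t : bool) (q n : nat) (P R : bool -> {poly k}) (p r u v : {poly k}) (phi psi
  : G).

Let vdiff_lin := vdiff_linear a h0 h x y.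
Let wordd_lin := wordd_linear x y.
Let divd_lin := divd_linear a h0 h.
Let wcochain_lin := wcochain_linear h0 h x y.

Lemma a_neq0 : a != 0.
Proof. by rewrite -size_poly_gt0 (ltn_trans _ Ha). Qed.

Lemma smallND n phi psi : smallN n phi -> smallN n psi -> smallN n (phi + psi).
Proof.
case: n => [|n] /=; first by move=> -> ->; rewrite addr0.
move=> [f Kf <-] [g Kg_g <-]; exists (f + g); last exact: (lfunD (vdiff_lin _)).
by rewrite -[f]scale1r; apply: grid_lin.
Qed.

Lemma smallZ_lin n c phi psi : smallZ n phi -> smallZ n psi -> smallZ n (c *: phi + psi).
Proof.
move=> [K1 d1] [K2 d2]; split; first exact: grid_lin.
by rewrite vdiff_lin d1 d2 scaler0 addr0.
Qed.
Lemma smallZB n phi psi : smallZ n phi -> smallZ n psi -> smallZ n (phi - psi).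
Proof. by move=> Z1 Z2; rewrite addrC -scaleN1r; apply: smallZ_lin. Qed.
Lemma smallZ_vdiff n psi : grid 0 n psi -> smallZ n.+1 (vdiff n psi).
Proof. by move=> K; split; [exact: grid_vdiff | exact: (vdiff_vdiff HB K)]. Qed.

Lemma grid_wpair q P R : (q = 0%N -> shift_sym R) -> grid 0 q.+1 (wpair q P R).
Proof.
move=> sR; split=> [[] e|//|[q0]]; [exact: mlinF_wcochain | exact: mlinF_wcochain |].
by rewrite /wpair; move: (sR q0); rewrite q0 => /(wcochain_shift_sym HB).
Qed.

Lemma vdiff_wpair q P R : vdiff q.+1 (wpair q P R) =
  fun t => if t then - wcochain q.+1 (polyd q R) else wcochain q.+2 (polyd q.+1 P) - divd q
    (wcochain q R).
Proof.
apply/funext => -[]; rewrite /vdiff /wpair /= ?(adh_wcochain HB) ?(wordd_wcochain HB) //.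
by rewrite sub0r.
Qed.

Lemma wpair_linear q P R P' R' c : c *: wpair q P R + wpair q P' R' = wpair q (c *: P + P') (c
  *: R + R').
Proof. by apply/funext => -[]; rewrite !fappE /wpair wcochain_lin. Qed.

Lemma polyd_linear q : linear (polyd q).
Proof.
move=> c P R; apply/funext => e; rewrite /polyd !fappE; case: (odd q).
  by rewrite addrACA -scalerDr mulrDr -scalerAr.
by rewrite opprD addrACA -scalerBr.
Qed.

(** Exactness of the complex of words in odd degrees: a (P true + P false) = 0 forces the sum to
    vanish, as a is nonzero. *)
Lemma boundary_even q phi : ~~ odd q -> smallZ q.+1 phi -> phi true = 0 -> smallN q.+1 phi.
Proof.
move=> oq [[mphi _ _] dphi] p0.
have k0 : adh q.+1 (phi false) = 0.
  have := congr1 (fun P : G => P true) dphi.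
  by rewrite /vdiff p0 (lfun0 (wordd_lin _)) subr0.
have [P PE] := adh_ker Hchar Hh0 HB (mphi false) k0.
have : polyd q.+1 P = 0.
  apply: (wcochain_inj HB (q := q.+2)); rewrite -(wordd_wcochain HB) -PE.
  have := congr1 (fun P : G => P false) dphi.
  by rewrite /vdiff p0 (lfun0 (divd_lin _)) subr0.
move=> /(congr1 (fun P : bool -> {poly k} => P true)) /eqP.
rewrite /polyd /= oq mulf_eq0 (negbTE a_neq0) /= => /eqP sP.
have [P0 [P0E sP0]] := polyd_even_exact Hchar a Hh0 oq sP.
exists (fun t => if t then 0 else wcochain q P0).
  split=> [[] e|q0|//]; [exact: mlin0 | exact: mlinF_wcochain |].
  by split=> //; move: (sP0 q0); rewrite q0 => /(wcochain_shift_sym HB).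
apply/funext => -[]; rewrite /vdiff.
  by rewrite (lfun0 (wordd_lin _)) (adh_wcochain HB) subr0 p0.
by rewrite (lfun0 (divd_lin _)) subr0 (wordd_wcochain HB) P0E -PE.
Qed.

(** Each class is represented by equal polynomials p on both words and 0 on the symbols. Boundaries
    contribute the multiples of a, through the words, and a' v, through the symbols. For q = 0 there
    is only one symbol h, so v is fixed by sigma and hence constant. *)
Lemma qdim_small_even q m : ~~ odd q ->
  qdim (fun _ : {poly k} => True)
    (fun p => exists u v, p = a * u + a^`() * v /\ (q = 0%N -> (size v <= 1)%N)) m ->
  qdim (smallZ q.+2) (smallN q.+2) m.
Proof.
move=> oq; have /negbTE oq' := oq.
apply: (qdim_map (E := fun p => wpair q.+1 (fun=> p) 0)).
- move=> c p r; rewrite wpair_linear; congr (wpair _ _ _).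
  by rewrite scaler0 addr0.
- exact: smallND.
- move=> p _; split; first exact: grid_wpair.
  rewrite vdiff_wpair (lfun0 (wcochain_lin _)) (lfun0 (divd_lin _)) subr0.
  apply/funext => -[]; rewrite /polyd /= oq' /=.
    rewrite -[fun _ => _]/((fun e => a * (0 + 0)) : bool -> {poly k}) addr0 mulr0.
    by rewrite (lfun0 (wcochain_lin _)) oppr0.
  by rewrite subrr; exact: (lfun0 (wcochain_lin _)).
- move=> phi Zphi; have [P [R [psi [[Kpsi phiE] dR _ _]]]] := cocycle_red Hchar Hh0 HB Zphi.
  have sR : R true + R false = 0.
    have /eqP := congr1 (fun P : bool -> {poly k} => P true) dR.
    by rewrite /polyd /= oq' mulf_eq0 (negbTE a_neq0) => /eqP.
  have [R0 [R0E sR0]] := polyd_even_exact Hchar a Hh0 oq sR.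
  (* Adding the boundary of [psi'] clears the component R and subtracts a' [R0] from P. *)
  pose psi' := wpair q 0 R0; pose P1 := P - (fun e => a^`() * R0 e).
  have Kpsi' : grid 0 q.+1 psi' by exact: grid_wpair.
  have phi1 : phi = vdiff q.+1 (psi - psi') + wpair q.+1 P1 0.
    have dpsi' : vdiff q.+1 psi' = wpair q.+1 P1 0 - wpair q.+1 P R.
      rewrite /psi' vdiff_wpair; apply/funext => -[]; rewrite !fappE /wpair.
        by rewrite R0E (lfun0 (wcochain_lin _)) sub0r.
      rewrite (lfun0 (polyd_linear _)) (lfun0 (wcochain_lin _)) sub0r divd_wcochain //.
      by rewrite (lfunB (wcochain_lin _)) addrAC subrr sub0r.
    by rewrite phiE (lfunB (vdiff_lin _)) dpsi' opprB -addrA subrK.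
  have dP1 : polyd q.+2 P1 = 0.
    apply: (wcochain_inj HB (q := q.+3)).
    have [_] := Zphi; rewrite phi1 (lfunD (vdiff_lin _)) (vdiff_vdiff HB (gridB Kpsi Kpsi'))
      add0r vdiff_wpair.
    move=> /(congr1 (fun P : G => P false)).
    by rewrite (lfun0 (wcochain_lin _)) (lfun0 (divd_lin _)) subr0.
  exists (P1 true) => //; exists (psi - psi'); first exact: gridB.
  rewrite [in RHS]phi1 -addrA; apply/esym/eqP; rewrite -subr_eq0 addrAC subrr add0r.
  rewrite subr_eq0; apply/eqP; congr (wpair _ _ _); apply/funext => -[] //.
  have /eqP := congr1 (fun P : bool -> {poly k} => P true) dP1.
  by rewrite /polyd /= negbK oq' subr_eq0 => /eqP.
- move=> p; split=> [[u [v [-> sv]]]|/(boundary_red Hchar Hh0 HB)[P' [R' [R0 P'E sR']]]].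
    exists (wpair q (fun e => if e then u else 0) (fun=> - v)).
      by apply: grid_wpair => q0; rewrite /shift_sym (size1_polyC (sv q0)) /sh -polyCN
        comp_polyC.
    rewrite vdiff_wpair; apply/funext => -[]; rewrite /wpair.
      have -> : polyd q (fun=> - v) = 0 by apply/funext => e; rewrite /polyd oq' subrr.
      by rewrite (lfun0 (wcochain_lin _)) oppr0.
    rewrite divd_wcochain // -(lfunB (wcochain_lin _)); congr (wcochain _ _); apply/funext => e;
      rewrite !fappE.
    rewrite /polyd /= oq' /= mulrN opprK; congr (a * _ + _).
    by case: e; rewrite ?addr0 ?add0r.
  have Rtf : R' true = R' false.
    have /eqP := congr1 (fun P : bool -> {poly k} => P true) R0.
    by rewrite !fappE eq_sym oppr_eq0 /polyd oq' subr_eq0 => /eqP.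
  exists (P' true + P' false), (- R' true); split; last first.
    move=> /sR'; rewrite /shift_sym -Rtf size_polyN => /esym; exact: (sh_fix Hchar Hh0).
  have : (fun=> p) - (polyd q.+1 P' - (fun e => a^`() * R' e)) = 0 :> (bool -> {poly k}).
    apply: (wcochain_inj HB (q := q.+2)); rewrite !(lfunB (wcochain_lin _)) -divd_wcochain //.
    by rewrite P'E subrr.
  move=> /(congr1 (fun P : bool -> {poly k} => P true)) /eqP.
  by rewrite !fappE subr_eq0 /polyd /= oq' /= mulrN => /eqP.
Qed.

(** A cocycle has equal components p on the symbols and satisfies a (P true + P false) = a' p. By
    [boundary_even] its class depends on p alone, and it vanishes when a divides p. *)
Lemma qdim_small_odd q m : odd q ->
  qdim (fun p => a %| a^`() * p) (fun p => a %| p) m ->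
  qdim (smallZ q.+2) (smallN q.+2) m.
Proof.
move=> oq; pose Ph p e : {poly k} := if e then (a^`() * p) %/ a else 0.
have oq1 : ~~ odd q.+1 by rewrite /= oq.
have ZE p : a %| a^`() * p -> smallZ q.+2 (wpair q.+1 (Ph p) (fun=> p)).
  move=> ap; split; first exact: grid_wpair.
  rewrite vdiff_wpair; apply/funext => -[].
    have -> : polyd q.+1 (fun=> p) = 0 by apply/funext => e; rewrite /polyd (negbTE oq1) subrr.
    by rewrite (lfun0 (wcochain_lin _)) oppr0.
  rewrite divd_wcochain // -(lfunB (wcochain_lin _)) [X in wcochain _ X](_ : _ = 0) ?(lfun0 (wcochain_lin
    _)) //.
  apply/funext => e; rewrite !fappE /polyd /= negbK oq /Ph.
  by case: e; rewrite /= ?addr0 ?add0r mulrC divpK // subrr.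
apply: (qdim_map (E := fun p => wpair q.+1 (Ph p) (fun=> p))).
- move=> c p r; rewrite wpair_linear; congr (wpair _ _ _); apply/funext => -[];
  rewrite !fappE /Ph.
    by rewrite mulrDr divpD -scalerAr divpZl.
  by rewrite scaler0 addr0.
- exact: smallND.
- exact: ZE.
- move=> phi Zphi; have [P [R [psi [[Kpsi phiE] dR PR _]]]] := cocycle_red Hchar Hh0 HB Zphi.
  have Rtf : R true = R false.
    have /eqP := congr1 (fun P : bool -> {poly k} => P true) dR.
    by rewrite /polyd (negbTE oq1) subr_eq0 => /eqP.
  have aR : a * (P true + P false) = a^`() * R true.
    have : polyd q.+2 P - (fun e => a^`() * R e) = 0.
      apply: (wcochain_inj HB (q := q.+3));
        rewrite (lfunB (wcochain_lin _)) PR divd_wcochain // subrr.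
      by [].
    move=> /(congr1 (fun P : bool -> {poly k} => P true)) /eqP.
    by rewrite !fappE subr_eq0 /polyd /= negbK oq => /eqP.
  have aR' : a %| a^`() * R true by rewrite -aR dvdp_mulr.
  exists (R true) => //; rewrite -[_ - _](subrK (vdiff q.+1 psi)).
  apply: smallND; last by exists psi.
  apply: (boundary_even oq1).
    by apply: smallZB (smallZ_vdiff Kpsi); apply: smallZB (ZE _ aR').
  have addK (f g g' : G) : f + g - g' - f = g - g' by rewrite addrAC [f + g - f]addrAC subrr
    add0r.
  rewrite phiE addK !fappE /wpair -(lfunB (wcochain_lin _)).
  rewrite (_ : R - _ = 0) ?(lfun0 (wcochain_lin _)) //.
  by apply/funext => -[]; rewrite !fappE ?Rtf subrr.
- move=> p; split=> [ap|/(boundary_red Hchar Hh0 HB)[P' [R' [R0 _ _]]]].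
    pose R' e := if e then - (p %/ a) else 0.
    have Kpsi : grid 0 q.+1 (wpair q 0 R') by apply: grid_wpair => q0; rewrite q0 in oq.
    rewrite -[wpair _ _ _](subrK (vdiff q.+1 (wpair q 0 R'))).
    apply: smallND; last by exists (wpair q 0 R').
    apply: (boundary_even oq1).
      by apply: smallZB (smallZ_vdiff Kpsi); apply: ZE; rewrite dvdp_mull.
    rewrite vdiff_wpair !fappE /wpair opprK -(lfunD (wcochain_lin _)) (_ : _ + _ = 0) ?(lfun0
      (wcochain_lin _)) //.
    apply/funext => -[]; rewrite !fappE /polyd oq /R' /= ?addr0 ?add0r mulrN mulrC divpK //;
    by rewrite subrr.
  have := congr1 (fun P : bool -> {poly k} => P true) R0.
  by rewrite !fappE /polyd oq => ->; rewrite -mulrN dvdp_mulr.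
Qed.

(** The component R is fixed by sigma, hence a constant c with a dividing c a'. Since a' is nonzero
    of smaller degree than a, c = 0 and [boundary_even] applies. *)
Lemma qdim_small_one : qdim (smallZ 1) (smallN 1) 0.
Proof.
apply: qdim0 => phi Zphi.
have [P [R [psi [[Kpsi phiE] dR PR sR]]]] := cocycle_red Hchar Hh0 HB Zphi.
have Rtf : R true = R false.
  have /eqP := congr1 (fun P : bool -> {poly k} => P true) dR.
  by rewrite /polyd subr_eq0 => /eqP.
have sR1 : (size (R true) <= 1)%N.
  by apply: (sh_fix Hchar Hh0); rewrite {1}Rtf -(sR erefl).
have aR : a * (P true + P false) = a^`() * R true.
  have : polyd 1 P - (fun e => a^`() * R e) = 0.
    apply: (wcochain_inj HB (q := 2)); rewrite (lfunB (wcochain_lin _)) PR divd_wcochain // subrr.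
    by [].
  move=> /(congr1 (fun P : bool -> {poly k} => P true)) /eqP.
  by rewrite !fappE subr_eq0 /polyd => /eqP.
have a'0 : a^`() != 0.
  by rewrite -size_poly_gt0 (size_deriv_char0 Hchar) -subn1 subn_gt0.
have Rt0 : R true = 0.
  apply/eqP; apply: contraT => Rn0.
  have : a %| a^`() * R true by rewrite -aR dvdp_mulr.
  rewrite (size1_polyC sR1) mulrC mul_polyC dvdpZr; last first.
    by apply: contra Rn0 => /eqP c0; rewrite (size1_polyC sR1) c0.
  by move=> /(dvdp_leq a'0); rewrite leqNgt lt_size_deriv ?a_neq0.
have R0 : R = 0 by apply/funext => -[]; rewrite fappE -?Rtf.
rewrite -[phi](subrK (vdiff 0 psi)); apply: smallND; last by exists psi.
apply: boundary_even => //; first by apply: smallZB (smallZ_vdiff Kpsi).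
by rewrite phiE R0 !fappE addrAC subrr add0r /wpair (lfun0 (wcochain_lin _)).
Qed.

End SmallCohomology2.

(** * Dimensions of the quotients of k[h] *)

Section PolyQuotients.
Variables (k : fieldType) (Hchar : [pchar k] =i pred0) (a : {poly k}) (Ha : (1 < size a)%N).
Implicit Types (p r u v : {poly k}).
Local Notation g := (gcdp a a^`()).

(** Polynomials of size at most m meet every class, and only 0 among them lies in N, so the powers
    of the variable below m give a basis. *)
Lemma qdim_poly (N : {poly k} -> Prop) m :
  (forall p, exists2 r : {poly k}, (size r <= m)%N & N (p - r)) ->
  (forall p, (size p <= m)%N -> N p -> p = 0) ->
  qdim (fun _ => True) N m.
Proof.
move=> Nr N0.
have polyE (coef : 'I_m -> k) (i : 'I_m) : (\sum_(j < m) coef j *: 'X^j)`_i = coef i.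
  rewrite coef_sum (bigD1 i) //= coefZ coefXn eqxx mulr1 big1 ?addr0 // => j ji.
  by rewrite coefZ coefXn eq_sym val_eqE (negbTE ji) mulr0.
exists (fun j => 'X^j); split=> // [p _|coef Nc j].
  have [r ract Npr] := Nr p; exists (fun j => r`_j).
  suff <- : r = \sum_(j < m) r`_j *: 'X^j by [].
  apply/polyP => i; have [im|mi] := ltnP i m; first by rewrite (polyE _ (Ordinal im)).
  rewrite nth_default ?(leq_trans ract) // nth_default //.
  apply: leq_trans (size_sum _ _ _) _; apply/bigmax_leqP => j _.
  by apply: leq_trans (size_scale_leq _ _) _; rewrite size_polyXn (leq_trans (ltn_ord j)).
rewrite -(polyE coef j) [\sum_(i < m) _](N0 _ _ Nc) ?coef0 //.
apply: leq_trans (size_sum _ _ _) _; apply/bigmax_leqP => i _.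
by apply: leq_trans (size_scale_leq _ _) _; rewrite size_polyXn ltn_ord.
Qed.

Let a0 : a != 0. Proof. by rewrite -size_poly_gt0 (ltn_trans _ Ha). Qed.
Let g0 : g != 0. Proof. by rewrite gcdp_eq0 (negbTE a0). Qed.

Lemma qdim_gcd : qdim (fun _ : {poly k} => True) (fun p => g %| p) (size g).-1.
Proof.
apply: qdim_poly => [p|p pg]; last first.
  case: (eqVneq p 0) => [//|p0 /(dvdp_leq p0) gp]; exfalso.
  move: (leq_trans gp pg) g0; rewrite -size_poly_gt0.
  by case: (size g) => //= l; rewrite ltnn.
exists (p %% g); first by move: (ltn_modp p g); rewrite g0; case: (size g).
by rewrite {1}(divp_eq p g) addrK dvdp_mull.
Qed.

Lemma qdim_ideal (q : nat) : q != 0%N ->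
  qdim (fun _ : {poly k} => True)
    (fun p => exists u v, p = a * u + a^`() * v /\ (q = 0%N -> (size v <= 1)%N)) (size g).-1.
Proof.
move=> q0; apply: qdim_iff qdim_gcd => p; split=> [/dvdpP[s ->]|[u [v [-> _]]]]; last first.
  by rewrite dvdp_add // dvdp_mulr ?dvdp_gcdl ?dvdp_gcdr.
(* Bezout holds up to a unit only; the factor [c1 / c2] corrects it. *)
have [[u v] /= /eqpP[[c1 c2] /andP[c10 c20] /= uv]] := Bezoutp a a^`().
exists ((c1 / c2) *: (s * u)), ((c1 / c2) *: (s * v)); split; last by move=> e; rewrite e in q0.
rewrite -!scalerAr -scalerDr [c1 / c2]mulrC -scalerA -[X in _ = c2^-1 *: X]/_.
have -> : a * (s * u) + a^`() * (s * v) = s * (u * a + v * a^`()) by ring.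
by rewrite scalerAr uv -scalerAr scalerA mulVf // scale1r.
Qed.

(** The denominator is (a) + k a'. Reducing modulo a leaves degree below deg a, and a multiple of
    a', whose degree is exactly deg a - 1, removes one more coefficient. *)
Lemma qdim_ideal_const :
  qdim (fun _ : {poly k} => True)
    (fun p => exists u v, p = a * u + a^`() * v /\ (0%N = 0%N -> (size v <= 1)%N))
    ((size a).-1 - 1).
Proof.
have sa' := size_deriv_char0 Hchar a.
have a'0 : a^`() != 0 by rewrite -size_poly_gt0 sa' -subn1 subn_gt0.
have [n sa] : exists n, size a = n.+2 by exists (size a).-2; move: Ha; lia.
rewrite sa /= subn1 /=; rewrite sa /= in sa'.
apply: qdim_poly => [p|p pn [u [v [pE sv]]]].
  pose r := p %% a; have rs : (size r <= n.+1)%N.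
    by have := ltn_modp p a; rewrite a0 sa.
  pose c := r`_n / lead_coef a^`(); exists (r - c *: a^`()).
    apply/leq_sizeP => j; rewrite leq_eqVlt coefB coefZ => /orP[/eqP<-|nj].
      by rewrite /c lead_coefE sa' /= divfK ?subrr // -[n]/(n.+1.-1) -sa' -lead_coefE
        lead_coef_eq0.
    by rewrite !nth_default ?mulr0 ?subr0 ?sa' //; exact: leq_trans rs nj.
  exists (p %/ a), c%:P; split; last by move=> _; rewrite size_polyC; case: (c != 0).
  by rewrite {1}(divp_eq p a) -/r opprB [c *: _ - r]addrC addrA addrK mulrC [_ * c%:P]mulrC
    mul_polyC.
have vE := size1_polyC (sv erefl).
(* A degree comparison: p and a' v both have degree below that of a. *)
have u0 : u = 0.
  apply/eqP; apply: contraT => u0.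
  have : (size (a * u)%R <= n.+1)%N.
    rewrite (_ : a * u = p - a^`() * v); last by rewrite pE addrK.
    apply: leq_trans (size_polyD _ _) _;
      rewrite geq_max (leq_trans pn) // size_polyN vE mulrC mul_polyC.
    by apply: leq_trans (size_scale_leq _ _) _; rewrite sa'.
  by rewrite size_mul // sa addSn /= -[X in (_ <= X)%N]addn0 leq_add2l leqn0 size_poly_eq0
    (negbTE u0).
move: pE; rewrite u0 mulr0 add0r vE mulrC mul_polyC => pE.
case: (eqVneq v`_0 0) pE => [->|v0] pE; first by rewrite pE scale0r.
by move: pn; rewrite pE size_scale // sa' ltnn.
Qed.

(** The factors get their own names because in the application a occurs on both sides of its
    factorization a = (a / g) g. *)
Lemma dvdp_mul_coprime (b b' A A' c p : {poly k}) :
  c != 0 -> coprimep A A' -> b = A * c -> b' = A' * c -> (b %| b' * p) = (A %| p).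
Proof. by move=> c0 cop -> ->; rewrite mulrAC dvdp_mul2r // Gauss_dvdpr. Qed.

Lemma dvdp_mul_cancel (b A c p : {poly k}) :
  A != 0 -> b = A * c -> (b %| A * p) = (c %| p).
Proof. by move=> A0 ->; rewrite dvdp_mul2l. Qed.

(** With g the gcd, a divides a' p exactly when a / g divides p, so multiplication by a / g maps
    k[h]/(g) isomorphically onto the annihilator of a' in k[h]/(a). *)
Lemma qdim_annihilator :
  qdim (fun p => a %| a^`() * p) (fun p => a %| p) (size g).-1.
Proof.
have aE : a = (a %/ g) * g by rewrite divpK // dvdp_gcdl.
have a'E : a^`() = (a^`() %/ g) * g by rewrite divpK // dvdp_gcdr.
have ag0 : a %/ g != 0 by apply: contraNneq a0 => e; rewrite aE e mul0r.
have Zg p : (a %| a^`() * p) = (a %/ g %| p).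
  by apply: dvdp_mul_coprime g0 _ aE a'E; apply: coprimep_div_gcd; rewrite a0.
have Ng p : (a %| a %/ g * p) = (g %| p) by apply: dvdp_mul_cancel aE.
apply: (qdim_map (E := fun r => (a %/ g) * r)) qdim_gcd.
- by move=> c u v; rewrite mulrDr -scalerAr.
- by move=> u v; exact: dvdp_add.
- by move=> p _; rewrite Zg dvdp_mulr.
- by move=> p; rewrite Zg => /dvdpP[r ->]; exists r => //; rewrite mulrC subrr dvdp0.
- by move=> p; rewrite Ng.
Qed.
End PolyQuotients.

(** * The centre, that is, degree zero *)

Section Center.
Variables (k : fieldType) (Hchar : [pchar k] =i pred0).
Variables (a : {poly k}) (h0 : k) (Hh0 : h0 != 0) (B : algType k) (h x y : B).
Hypothesis HB : is_GWA a h0 h x y.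

Lemma hochd_mlin0 (f : seq B -> B) b : mlin 0 f -> hochd f [:: b] = b * f [::] - f [::] * b.
Proof. by move=> mf; rewrite /hochd addappE /aug bard_cons /ract /bard /= subr0. Qed.

(** An element commuting with h is a polynomial in h; commuting with x and y as well makes it fixed
    by sigma, hence constant. *)
Lemma qdim_center : qdim (@barZ k B 0) (@barN k B 0) 1.
Proof.
exists (fun=> cst0 1); split=> [_|f [mf df]|coef].
- split; first exact: mlin_cst.
  apply/funext => s; have [|sn] := eqVneq (size s) 1%N; last first.
    by rewrite (mlin_size (mlin_hochd (mlin_cst _)) sn).
  by case: s => [|b [|]] // _; rewrite hochd_mlin0 //= mulr1 mul1r subrr.
- have cent b : b * f [::] = f [::] * b.
    by apply/eqP; rewrite -subr_eq0 -(hochd_mlin0 _ mf) df.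
  pose F (e : bool) := f.
  have mF : mlinF 0 F by [].
  have fE := cst0E mf.
  have kF : adh h0 h 0 F = 0.
    by apply/funext => e; rewrite /adh /F fE lact_cst ract_cst cent /pre addbF subrr.
  have [P FP] := adh_ker Hchar Hh0 HB mF kF.
  have dF : wordd x y 0 F = 0.
    by apply/funext => e; rewrite /wordd /F fE lact_cst ract_cst cent /pre addbF expr1
      scaleN1r subrr.
  have P0 : P true = P false.
    have := dF; rewrite FP (wordd_wcochain HB) => /(wcochain_inj HB).
    move=> /(congr1 (fun P : bool -> {poly k} => P true)) /eqP.
    by rewrite /polyd subr_eq0 => /eqP.
  have sP : (size (P true) <= 1)%N.
    have : wcochain h0 h x y 0 P true = wcochain h0 h x y 0 P false by rewrite -FP.
    by move/(wcochain_shift_sym HB); rewrite /shift_sym -P0 => /esym; exact: (sh_fix Hchar Hh0).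
  exists (fun=> (P true)`_0); rewrite /barN big_ord1; apply/eqP; rewrite subr_eq0; apply/eqP.
  rewrite -[f]/(F true) FP /wcochain /welt /= mul1r (size1_polyC sP) -(lfunZ (@cst_linear k B)).
  by rewrite peval_horner horner_algC coefC.
- rewrite /barN big_ord1 -(lfunZ (@cst_linear k B)) => /cst_inj/eqP.
  by rewrite scaler_eq0 oner_eq0 orbF => /eqP c0 j; rewrite ord1.
Qed.
End Center.

Theorem theorem1p2 (k : fieldType) (Hchar : [pchar k] =i pred0)
  (a : {poly k}) (Ha : (1 < size a)%N) (h0 : k) (Hh0 : h0 != 0)
  (B : algType k) (h x y : B) (HB : is_GWA a h0 h x y) :
  let n := (size a).-1 in
  let d := (size (gcdp a a^`())).-1 in
  (d = 0%N ->
     [/\ HH_dim B 0 1, HH_dim B 2 (n - 1)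
       & forall i : nat, i != 0%N -> i != 2%N -> HH_dim B i 0]) /\
  ((1 <= d)%N ->
     [/\ HH_dim B 0 1, HH_dim B 1 0, HH_dim B 2 (n - 1)
       & forall i : nat, (3 <= i)%N -> HH_dim B i d]).
Proof.
move=> n d.
have H0 : HH_dim B 0 1 := HH_dim_of_bar (qdim_center Hchar Hh0 HB).
have H1 : HH_dim B 1 0 := HH_dim_of_small HB (qdim_small_one Hchar Ha Hh0 HB).
have H2 : HH_dim B 2 (n - 1).
  apply: (HH_dim_of_small HB); apply: (qdim_small_even Hchar Ha Hh0 HB) => //.
  exact: qdim_ideal_const.
have H3 i : (3 <= i)%N -> HH_dim B i d.
  case: i => [|[|[|q]]] // _; apply: (HH_dim_of_small HB).
  (* The degree is [q.+1] plus 2. Odd degrees give the annihilator of a', even ones the quotient by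
     (a, a'), and both have dimension d. *)
  have [oq|eq] := boolP (odd q.+1).
    by apply: (qdim_small_odd Hchar Ha Hh0 HB oq); exact: qdim_annihilator.
  by apply: (qdim_small_even Hchar Ha Hh0 HB eq); exact: qdim_ideal.
split=> [d0|_]; split=> //.
by case=> [|[|[|i]]] // _ _; rewrite -d0; apply: H3.
Qed.
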